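(* Let $(\pi_\epsilon)_{\epsilon>0}$ be a family of discrete probability distributions on $\mathbb{R}$, each with zero mean, unit variance and finite entropy $H_\epsilon := H(\pi_\epsilon)$, whose single-letter MMSE functions $M_\epsilon$ satisfy $$\lim_{\epsilon\to 0} M_\epsilon(2H_\epsilon t) = \begin{cases} 1, & t\in[0,1)\\ 0, & t\in(1,\infty).\end{cases}$$ Let $r\in(0,1)\cup(1,\infty)$ and let $(\delta_\epsilon,\mathsf{snr}_\epsilon,\pi_\epsilon)_{\epsilon>0}$ be a family of triplets with $\delta_\epsilon,\mathsf{snr}_\epsilon\in(0,\infty)$ such that $$\lim_{\epsilon\to 0}\frac{\delta_\epsilon}{\delta_{\epsilon,\mathrm{MMSE}}} = r,\qquad \text{where } \delta_{\epsilon,\mathrm{MMSE}} := \frac{2H_\epsilon}{\log(1+\mathsf{snr}_\epsilon)}.$$ Let $\underline{s}^*_\epsilon$ and $\overline{s}^*_\epsilon$ be the smallest and largest minimizers over $s>0$ of the potential function $\mathcal{F}_\epsilon$ associated with $(\delta_\epsilon,\mathsf{snr}_\epsilon,\pi_\epsilon)$. Then: $$r\in(0,1)\ \Longrightarrow\ \lim_{\epsilon\to0} M_\epsilon(\overline{s}^*_\epsilon) = 1,\qquad\qquad r\in(1,\infty)\ \Longrightarrow\ \lim_{\epsilon\to0} M_\epsilon(\underline{s}^*_\epsilon)=0.$$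
   Context: Logarithms are natural and entropies and mutual informations are in nats. For a distribution $\pi_\epsilon$, let $\beta_0\sim\pi_\epsilon$ and $N\sim\mathcal{N}(0,1)$ be independent. For $s\ge 0$ define the single-letter mutual information and MMSE functions $$I_\epsilon(s) := I(\beta_0;\sqrt{s}\,\beta_0+N),\qquad M_\epsilon(s) := \mathbb{E}\big[(\beta_0-\mathbb{E}[\beta_0\mid \sqrt{s}\,\beta_0+N])^2\big].$$ The potential function associated with $(\delta_\epsilon,\mathsf{snr}_\epsilon,\pi_\epsilon)$ is $$\mathcal{F}_\epsilon(s) := I_\epsilon(s)+\frac{\delta_\epsilon}{2}\,\phi\!\left(\frac{s}{\delta_\epsilon\,\mathsf{snr}_\epsilon}\right),\quad s>0,\qquad \phi(x) := x-\log x-1.$$ Set $\mathcal{F}^*_\epsilon := \min_{s>0}\mathcal{F}_\epsilon(s)$, $\underline{s}^*_\epsilon := \min\{s:\mathcal{F}_\epsilon(s)=\mathcal{F}_\epsilon^*\}$ and $\overline{s}^*_\epsilon := \max\{s:\mathcal{F}_\epsilon(s)=\mathcal{F}_\epsilon^*\}$. *)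

(* Defs.v *)
From HB Require Import structures.
From mathcomp Require Import all_boot all_order all_algebra.
From mathcomp Require Import all_classical all_reals all_analysis.
From mathcomp Require Import measurable_realfun.

Set Implicit Arguments.
Unset Strict Implicit.
Unset Printing Implicit Defensive.

Import Order.TTheory GRing.Theory Num.Theory.
Import numFieldNormedType.Exports.

Local Open Scope classical_set_scope.
Local Open Scope ring_scope.
Local Open Scope charge_scope.
Local Open Scope ereal_scope.

(* Kullback-Leibler divergence D(nu || mu), in nats.  [lne 0 = -oo] is
   harmless: the density of nu vanishes only on a nu-null set. *)
Definition kl_divergence {d} {T : measurableType d} {R : realType}
    (nu mu : probability T R) : \bar R :=
  if `[< nu `<< mu >]
  then \int[nu]_x lne (('d (charge_of_finite_measure nu) '/d mu) x)
  else +oo.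

Section information.
Context d (T : measurableType d) (R : realType) (P : probability T R).
Variables X Y : {RV P >-> measurableTypeR R}.

Definition pair_rv (w : T) : (measurableTypeR R * measurableTypeR R)%type :=
  (X w, Y w).

Lemma measurable_pair_rv : measurable_fun [set: T] pair_rv.
Proof. by apply: measurable_fun_pair. Qed.

HB.instance Definition _ :=
  isMeasurableFun.Build _ _ _ _ pair_rv measurable_pair_rv.

Definition mutual_information : \bar R :=
  kl_divergence (distribution P pair_rv) (distribution P X \x distribution P Y).

Definition is_cond_expectation (Z : T -> R) : Prop :=
  [/\ forall B : set (measurableTypeR R), measurable B ->
        g_sigma_algebra_preimage Y (Z @^-1` B),
      P.-integrable [set: T] (EFin \o Z) &
      forall A, g_sigma_algebra_preimage Y A ->
        \int[P]_(w in A) (Z w)%:E = \int[P]_(w in A) (X w)%:E].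

(* A version of E[X | Y]; it is unique up to P-null sets and exists as soon as
   X is integrable, so the default value of [xget] plays no role then. *)
Definition cond_expectation : T -> R :=
  xget (cst 0%R) [set Z | is_cond_expectation Z].

Definition mmse : \bar R :=
  'E_P[fun w => ((X w - cond_expectation w) ^+ 2)%R].

End information.

Section gaussian_channel.
Context (R : realType).
Implicit Types (pi : probability (measurableTypeR R) R) (s : R).

(* The joint law of independent beta_0 ~ pi and N ~ N(0, 1), on whose sample
   space R * R the two variables are the coordinate projections. *)
Definition channel_prob pi :
    probability (measurableTypeR R * measurableTypeR R)%type R :=
  pi \x normal_prob (0%R : R) (1%R : R).

Definition signal (w : measurableTypeR R * measurableTypeR R) :
  measurableTypeR R := w.1.

Definition noise (w : measurableTypeR R * measurableTypeR R) :
  measurableTypeR R := w.2.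

Definition observation s (w : measurableTypeR R * measurableTypeR R) :
  measurableTypeR R := (Num.sqrt s * signal w + noise w)%R.

Lemma measurable_signal : measurable_fun setT signal.
Proof. exact: measurable_fst. Qed.

HB.instance Definition _ :=
  isMeasurableFun.Build _ _ _ _ signal measurable_signal.

Lemma measurable_observation s : measurable_fun setT (observation s).
Proof.
apply: measurable_funD; last exact: measurable_snd.
by apply: measurable_funM => //; exact: measurable_fst.
Qed.

HB.instance Definition _ s :=
  isMeasurableFun.Build _ _ _ _ (observation s) (measurable_observation s).

Definition sl_mutual_information pi s : \bar R :=
  mutual_information (P := channel_prob pi) signal (observation s).

Definition sl_mmse pi s : \bar R :=
  mmse (P := channel_prob pi) signal (observation s).

End gaussian_channel.

Section potential.
Context (R : realType).
Implicit Types (pi : probability (measurableTypeR R) R) (delta snr s : R).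

Definition discrete_distribution pi : Prop :=
  exists2 A : set R, countable A & pi A = 1.

(* Shannon entropy in nats; [ln 0 = 0], so points outside the support
   contribute 0 to this sum of nonnegative terms. *)
Definition entropy pi : \bar R :=
  \esum_(x in [set: R]) (- (fine (pi [set x]) * ln (fine (pi [set x]))))%R%:E.

Definition delta_mmse pi snr : R :=
  (2 * fine (entropy pi) / ln (1 + snr))%R.

Definition phi (x : R) : R := (x - ln x - 1)%R.

Definition potential delta snr pi s : \bar R :=
  sl_mutual_information pi s + (delta / 2 * phi (s / (delta * snr)))%R%:E.

Definition minimizers (F : R -> \bar R) : set R :=
  [set s | (0 < s)%R /\ forall t, (0 < t)%R -> F s <= F t].

(* The default 0 is used only when no such minimizer exists; the potential is
   continuous on (0, +oo) and tends to +oo at both ends, so it has a smallest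
   and a largest minimizer. *)
Definition smallest_minimizer (F : R -> \bar R) : R :=
  xget 0%R [set s | minimizers F s /\ lbound (minimizers F) s].

Definition largest_minimizer (F : R -> \bar R) : R :=
  xget 0%R [set s | minimizers F s /\ ubound (minimizers F) s].

End potential.

(* Main.v *)
Require Import Defs.
From mathcomp Require Import all_boot all_order all_algebra.
From mathcomp Require Import all_classical all_reals all_analysis.
From mathcomp Require Import measurable_realfun ring lra.

(** Write X for the signal, N for the noise, Y_s = sqrt s X + N, gamma for the
standard Gaussian measure and H for the entropy of the prior.

The density of the law of Y_s with respect to gamma is the mixture
g_s(y) = E exp(sqrt s X y - s X^2/2) ([mlr]).  The mutual information is
I(s) = s/2 - D(s), where D(s) = E ln g_s(Y_s) is the divergence of the law of
Y_s from gamma ([output_kl], [info]), and the MMSE is M(s) = E (X - h_s(Y_s))^2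
with the posterior mean h_s = E[X | Y_s = .] ([post_mean], [mmse_fun]).

No I-MMSE differentiation is used; five elementary facts replace it.
- M is nonincreasing, D and I are nondecreasing.  For s1 < s2 the observation
  Y_s1 has the law of rho Y_s2 + sigma Z with Z an independent standard Gaussian
  ([degradation]), so M decreases because the posterior mean is the best
  estimator, and D and I increase by data processing, which comes down to
  Gibbs' inequality ([gibbs_integral]).
- D(s) <= s (1 - M(s)) ([output_kl_le]).  The function ln g_s is convex with
  derivative sqrt s h_s, so ln g_s(Y_s) - ln g_s(N) <= s X h_s(Y_s); moreover
  E ln g_s(N) <= 0 and E X h_s(Y_s) = 1 - M(s).
- I(s) <= H, because g_s(y) is at least the atom at x times its likelihood.

On s = 2 H t with t < 1 the hypothesis M -> 1 and the second fact give
I(2 H t) / H -> t, while I(s) <= s/2 and I <= H hold always: the mutual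
information is asymptotically min(s/2, H).  Let L = ln (1 + snr) and let
c = delta L / (2 H) be the ratio of delta to its threshold.  Replacing I by s/2
in the potential gives a function whose minimum is exactly c H
([linear_branch_ge], [potential_fun_le_linear]); replacing I by H gives a
function whose minimum is H.  As phi >= 0, a minimizer s > s0 = 2 H t forces
I(s0) <= c H ([minimizer_above]), which is impossible for r < t < 1; a minimizer
s <= s0 forces c H - D(s0) <= H ([minimizer_below]), which is impossible for
1 < t < r.  So the minimizers are below 2 H t for some t < 1, respectively above
2 H t for some t > 1, and the monotonicity of M concludes. *)

Set Implicit Arguments.
Unset Strict Implicit.
Unset Printing Implicit Defensive.

Import Order.TTheory GRing.Theory Num.Theory.
Import numFieldNormedType.Exports.

Local Open Scope classical_set_scope.
Local Open Scope ring_scope.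

(** * Densities, transfer of integrals and the Gibbs inequality *)

Section general_measure.
Local Open Scope ereal_scope.

Lemma density_dominates d (T : measurableType d) (R : realType)
    (nu : probability T R) (mu : {sigma_finite_measure set T -> \bar R})
    (p : T -> R) :
  measurable_fun [set: T] p ->
  (forall A, measurable A -> nu A = \int[mu]_(x in A) (p x)%:E) ->
  nu `<< mu.
Proof.
move=> mp nuE; apply/null_content_dominatesP => A mA muA0.
rewrite nuE//; apply: null_set_integral => //.
by apply/measurable_funTS/measurable_EFinP.
Qed.

Lemma density_integrable d (T : measurableType d) (R : realType)
    (nu : probability T R) (mu : {sigma_finite_measure set T -> \bar R})
    (p : T -> R) :
  measurable_fun [set: T] p -> (forall x, 0 <= p x)%R ->
  (forall A, measurable A -> nu A = \int[mu]_(x in A) (p x)%:E) ->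
  mu.-integrable setT (EFin \o p).
Proof.
move=> mp p0 nuE; apply/integrableP; split; first exact/measurable_EFinP.
under eq_integral do rewrite /= ger0_norm//.
by rewrite -nuE// probability_setT ltry.
Qed.

Lemma ge0_integral_density d (T : measurableType d) (R : realType)
    (nu : probability T R) (mu : {sigma_finite_measure set T -> \bar R})
    (p : T -> R) (f : T -> \bar R) :
  measurable_fun [set: T] p -> (forall x, 0 <= p x)%R ->
  (forall A, measurable A -> nu A = \int[mu]_(x in A) (p x)%:E) ->
  measurable_fun [set: T] f -> (forall x, 0 <= f x) ->
  \int[nu]_x f x = \int[mu]_x (f x * (p x)%:E).
Proof.
move=> mp p0 nuE mf f0.
have numu := density_dominates mp nuE.
rewrite -(Radon_Nikodym_SigmaFinite.change_of_variables numu)//.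
apply: ae_eq_integral => //.
- apply: emeasurable_funM => //.
  exact: measurable_int (Radon_Nikodym_SigmaFinite.f_integrable numu).
- by apply: emeasurable_funM => //; exact/measurable_EFinP.
- apply: ae_eqe_mul2l; apply: integral_ae_eq => //.
  + exact: Radon_Nikodym_SigmaFinite.f_integrable.
  + exact/measurable_EFinP.
  + move=> E _ mE; rewrite -(nuE _ mE).
    exact/esym/Radon_Nikodym_SigmaFinite.f_integral.
Qed.

(** Change of variables with a weight only has to be checked on nonnegative
functions: the signed case follows from the positive and negative parts. *)
Lemma integral_transfer d1 d2 d3 (T1 : measurableType d1)
    (T2 : measurableType d2) (T3 : measurableType d3) (R : realType)
    (mu1 : {measure set T1 -> \bar R}) (mu2 : {measure set T2 -> \bar R})
    (f1 : T1 -> T3) (f2 : T2 -> T3) (w : T2 -> R) :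
  measurable_fun setT f1 -> measurable_fun setT f2 -> measurable_fun setT w ->
  (forall t, 0 <= w t)%R ->
  (forall F : T3 -> \bar R, measurable_fun setT F -> (forall t, 0 <= F t) ->
    \int[mu1]_t F (f1 t) = \int[mu2]_t (F (f2 t) * (w t)%:E)) ->
  forall F : T3 -> R, measurable_fun setT F ->
  mu1.-integrable setT (fun t => (F (f1 t))%:E) ->
  mu2.-integrable setT (fun t => (F (f2 t) * w t)%:E) /\
  \int[mu1]_t (F (f1 t))%:E = \int[mu2]_t (F (f2 t) * w t)%:E.
Proof.
move=> mf1 mf2 mw w0 H F mF iF.
have mE : measurable_fun setT (EFin \o F) by exact/measurable_EFinP.
have wE t : (F (f2 t) * w t)%:E = (F (f2 t))%:E * (w t)%:E by [].
have posE t : ((fun t => (F (f2 t) * w t)%:E)^\+ t =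
    (EFin \o F)^\+ (f2 t) * (w t)%:E).
  by rewrite !funeposE wE maxe_pMl ?mul0e ?lee_fin//=.
have negE t : ((fun t => (F (f2 t) * w t)%:E)^\- t =
    (EFin \o F)^\- (f2 t) * (w t)%:E).
  by rewrite !funenegE wE maxe_pMl ?mul0e ?mulNe ?lee_fin//=.
have i2 : mu2.-integrable setT (fun t => (F (f2 t) * w t)%:E).
  apply/integrableP; split.
    by apply/measurable_EFinP/measurable_funM => //; exact: measurableT_comp.
  move/integrableP: iF => [_]; rewrite (H (fun t => `|(F t)%:E|))//.
    move=> fin; under eq_integral do rewrite wE abseM (@gee0_abs _ (w _)%:E) ?lee_fin//.
    exact: fin.
  exact: measurableT_comp.
split => //.
rewrite integralE [RHS]integralE; congr (_ - _).
- under [RHS]eq_integral do rewrite posE.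
  rewrite -(H ((EFin \o F)^\+))//; last exact: measurable_funepos.
  by apply: eq_integral => t _; rewrite !funeposE.
- under [RHS]eq_integral do rewrite negE.
  rewrite -(H ((EFin \o F)^\-))//; last exact: measurable_funeneg.
  by apply: eq_integral => t _; rewrite !funenegE.
Qed.

(** Integrate a - b <= exp (a - b) - 1.  All the data-processing inequalities
below are instances, with exp (a - b) a ratio of densities. *)
Lemma gibbs_integral d (T : measurableType d) (R : realType)
    (P : probability T R) (a b : T -> R) :
  P.-integrable setT (EFin \o a) -> P.-integrable setT (EFin \o b) ->
  \int[P]_t (expR (a t - b t))%:E <= 1 ->
  \int[P]_t (a t)%:E <= \int[P]_t (b t)%:E.
Proof.
move=> ia ib ab1.
have ma : measurable_fun setT a by apply/measurable_EFinP; exact: measurable_int ia.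
have mb : measurable_fun setT b by apply/measurable_EFinP; exact: measurable_int ib.
have ie : P.-integrable setT (fun t => (expR (a t - b t))%:E).
  apply/integrableP; split.
    by apply/measurable_EFinP/measurableT_comp => //; exact: measurable_funB.
  under eq_integral do rewrite gee0_abs ?lee_fin ?expR_ge0//.
  by rewrite (le_lt_trans ab1)// ltry.
have i1 : P.-integrable setT (fun=> 1%:E).
  exact: finite_measure_integrable_cst.
have ib1 : P.-integrable setT (EFin \o (fun t => b t + (expR (a t - b t) - 1))%R).
  apply: eq_integrable (integrableD measurableT ib (integrableB measurableT ie i1)) => // t _.
apply: (@le_trans _ _ (\int[P]_t (b t + (expR (a t - b t) - 1))%:E)).
  apply: le_integral => // t _; rewrite lee_fin.
  by have := expR_ge1Dx (a t - b t); lra.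
rewrite (_ : \int[P]_t _ = \int[P]_t (b t)%:E + (\int[P]_t (expR (a t - b t))%:E - 1)).
  by rewrite geeDl// sube_le0.
rewrite -[1]/(1%:E) -[in X in _ - X](_ : \int[P]_t (1%:E) = 1%:E); last first.
  by rewrite integral_cst// mul1e; exact: probability_setT.
rewrite -integralB// -integralD//.
exact: (integrableB measurableT ie i1).
Qed.

End general_measure.

(** * The standard Gaussian measure: affine changes of variable, shifts and rotations *)

Section gaussian.
Context (R : realType).
Local Open Scope ereal_scope.
Notation leb := (@lebesgue_measure R).
Notation gam := (normal_prob (0%R : R) (1%R : R)).

(** The pushforward of Lebesgue measure by z |-> a + sigma z, multiplied by
sigma, agrees with Lebesgue measure on intervals. *)
Lemma ge0_integral_affine (a sigma : R) (f : R -> \bar R) : (0 < sigma)%R ->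
  measurable_fun [set: R] f -> (forall x, 0 <= f x) ->
  sigma%:E * \int[leb]_z f (a + sigma * z)%R = \int[leb]_x f x.
Proof.
move=> s0 mf f0.
pose phi : measurableTypeR R -> measurableTypeR R := fun z => (a + sigma * z)%R.
have mphi : measurable_fun setT phi.
  by apply: measurable_funD => //; exact: measurable_funM.
pose sn := NngNum (ltW s0).
have H A : measurable A -> leb A = mscale sn (pushforward leb phi) A.
  apply: lebesgue_measure_unique => _ [[b c]] _ <- /=.
  rewrite /mscale/= /pushforward/=.
  have -> : phi @^-1` `]b, c] = `]((b - a) / sigma)%R, ((c - a) / sigma)%R]%classic.
    apply/seteqP; split => z /=; rewrite !in_itv/= /phi.
      by rewrite ltr_pdivrMr// ler_pdivlMr// ltrBlDl lerBrDl (mulrC z).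
    by rewrite ltr_pdivrMr// ler_pdivlMr// ltrBlDl lerBrDl (mulrC z).
  rewrite !lebesgue_measure_itv/= !lte_fin ltr_pM2r ?invr_gt0// ltrD2r.
  case: ifPn => bc; last by rewrite mule0.
  by rewrite -!EFinB -EFinM; congr (_%:E); field; rewrite gt_eqF.
rewrite [RHS](@eq_measure_integral _ _ _ setT (mscale sn (pushforward leb phi))); last first.
  by move=> A mA _; apply: H.
rewrite ge0_integral_mscale//=.
by rewrite ge0_integral_pushforward.
Qed.

Lemma ge0_integral_normal_prob (m s : R) (f : R -> \bar R) :
  measurable_fun [set: R] f -> (forall x, 0 <= f x) ->
  \int[normal_prob m s]_x f x = \int[leb]_x (f x * (normal_pdf m s x)%:E).
Proof.
move=> mf f0; apply: (@ge0_integral_density _ _ _ (normal_prob m s) leb) => //.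
- exact: measurable_normal_pdf.
- by move=> x; exact: normal_pdf_ge0.
Qed.

Lemma normal_prob_affine (a sigma : R) (f : R -> \bar R) : (0 < sigma)%R ->
  measurable_fun [set: R] f -> (forall x, 0 <= f x) ->
  \int[gam]_z f (a + sigma * z)%R = \int[normal_prob a sigma]_x f x.
Proof.
move=> s0 mf f0.
have maff : measurable_fun [set: R] (fun z => f (a + sigma * z)%R).
  apply: (measurableT_comp mf); apply: measurable_funD => //.
rewrite (ge0_integral_normal_prob 0 1 maff (fun z => f0 _)).
rewrite (ge0_integral_normal_prob a sigma mf f0).
rewrite -[RHS](@ge0_integral_affine a sigma)//; last 2 first.
- apply: emeasurable_funM => //; apply/measurable_EFinP.
  exact: measurable_normal_pdf.
- by move=> x; rewrite mule_ge0// lee_fin normal_pdf_ge0.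
rewrite -[RHS]ge0_integralZl//; last 3 first.
- apply: emeasurable_funM => //; apply/measurable_EFinP.
  apply: measurableT_comp; first exact: measurable_normal_pdf.
  by apply: measurable_funD => //; exact: measurable_funM.
- by move=> x _; rewrite mule_ge0// lee_fin normal_pdf_ge0.
- by rewrite lee_fin ltW.
apply: eq_integral => z _.
rewrite muleCA -EFinM; congr (_ * _%:E).
rewrite !normal_pdfE ?gt_eqF// /normal_peak /normal_fun.
rewrite mulrA; congr (_ * expR _)%R.
  rewrite expr1n mul1r -mulrnAr sqrtrM ?sqr_ge0// sqrtr_sqr gtr0_norm//.
  by rewrite invfM mulrA divff ?mul1r// gt_eqF.
by field; rewrite gt_eqF.
Qed.

(** Cameron-Martin formula: the law of a + N has density
exp (a y - a^2/2) with respect to the law of N. *)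
Lemma gaussian_shift (a : R) (f : R -> \bar R) :
  measurable_fun [set: R] f -> (forall x, 0 <= f x) ->
  \int[gam]_z f (a + z)%R = \int[gam]_y (f y * (expR (a * y - a ^+ 2 / 2))%:E).
Proof.
move=> mf f0.
transitivity (\int[gam]_z f (a + 1 * z)%R).
  by apply: eq_integral => z _; rewrite mul1r.
have mfe : measurable_fun [set: R]
    (fun y => f y * (expR (a * y - a ^+ 2 / 2))%:E).
  apply: emeasurable_funM => //; apply/measurable_EFinP/measurableT_comp => //.
  by apply: measurable_funB => //; exact: measurable_funM.
have fe0 y : 0 <= f y * (expR (a * y - a ^+ 2 / 2))%:E.
  by rewrite mule_ge0// lee_fin expR_ge0.
rewrite (normal_prob_affine a ltr01 mf f0) (ge0_integral_normal_prob a 1 mf f0).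
rewrite (ge0_integral_normal_prob 0 1 mfe fe0).
apply: eq_integral => y _; rewrite -muleA -EFinM; congr (_ * _%:E).
rewrite !normal_pdfE// /normal_peak /normal_fun mulrCA -expRD.
by congr (_ * expR _)%R; field.
Qed.

(** The law of (y, u) with u = rho y + sigma z has density n(rho y, sigma; u)
n(0, 1; y), which is symmetric in y and u: exchanging the integrations leaves
the integral in y of a normal density. *)
Lemma gaussian_rotation (rho sigma : R) (f : R -> \bar R) :
  (0 < sigma)%R -> (rho ^+ 2 + sigma ^+ 2 = 1)%R ->
  measurable_fun [set: R] f -> (forall x, 0 <= f x) ->
  \int[gam]_y \int[gam]_z f (rho * y + sigma * z)%R = \int[gam]_u f u.
Proof.
move=> s0 rs1 mf f0.
have mpdf m s : measurable_fun [set: R] (fun x => (normal_pdf m s x)%:E).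
  by apply/measurable_EFinP; exact: measurable_normal_pdf.
have kE y u : (normal_pdf (rho * y) sigma u * normal_pdf 0 1 y =
    normal_pdf (rho * u) sigma y * normal_pdf 0 1 u)%R.
  rewrite !normal_pdfE ?gt_eqF// /normal_peak /normal_fun.
  rewrite [LHS]mulrACA [RHS]mulrACA -!expRD; congr (_ * expR _)%R.
  have -> : (sigma ^+ 2 = 1 - rho ^+ 2)%R by rewrite -rs1 addrC addKr.
  field; rewrite -rs1 addrAC subrr add0r expf_eq0/=; exact: lt0r_neq0.
transitivity (\int[gam]_y \int[leb]_u (f u * (normal_pdf (rho * y) sigma u)%:E)).
  apply: eq_integral => y _; rewrite (normal_prob_affine (rho * y) s0 mf f0).
  exact: ge0_integral_normal_prob.
have mk : measurable_fun [set: R * R] (fun w => (normal_pdf (rho * w.1)%R sigma w.2)).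
  rewrite (_ : (fun w => _) = (fun w : R * R => normal_peak sigma *
      expR (- (w.2 - rho * w.1) ^+ 2 / (sigma ^+ 2 *+ 2)))%R); last first.
    by apply/funext => w; rewrite normal_pdfE ?gt_eqF.
  apply: measurable_funM => //; apply: measurableT_comp => //.
  apply: measurable_funM => //; apply: measurableT_comp => //.
  apply: (@measurable_funX _ _ _ _ (fun w : R * R => w.2 - rho * w.1)%R).
  apply: measurable_funB; first exact: measurable_snd.
  by apply: measurable_funM => //; exact: measurable_fst.
have mF : measurable_fun [set: measurableTypeR R * measurableTypeR R]
    (fun w => f w.2 * (normal_pdf (rho * w.1)%R sigma w.2)%:E).
  apply: emeasurable_funM; last exact/measurable_EFinP.
  exact: (measurableT_comp mf measurable_snd).
rewrite (@fubini_tonelli _ _ (measurableTypeR R) (measurableTypeR R) R gam leb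
  (fun w => f w.2 * (normal_pdf (rho * w.1)%R sigma w.2)%:E))//=; last first.
  by move=> w; rewrite mule_ge0// lee_fin normal_pdf_ge0.
rewrite ge0_integral_normal_prob//; apply: eq_integral => u _.
have mpu : measurable_fun [set: R] (fun y => (normal_pdf (rho * y)%R sigma u)%:E).
  apply/measurable_EFinP.
  exact: (measurableT_comp mk (measurable_pair2 u)).
have p0 m s x : 0 <= (normal_pdf m s x : R)%:E by rewrite lee_fin normal_pdf_ge0.
rewrite ge0_integralZl//; congr (_ * _).
rewrite ge0_integral_normal_prob//.
under eq_integral do rewrite -EFinM kE EFinM.
rewrite ge0_integralZr//; last exact: mpdf.
by rewrite [X in X * _](integral_normal_pdf _ _) mul1e.
Qed.

End gaussian.

(** * Marginals of product probabilities, Gaussian moments *)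

Section product_marginals.
Local Open Scope ereal_scope.

Lemma integral_prob_cst d (T : measurableType d) (R : realType)
  (P : probability T R) (c : \bar R) : \int[P]_x c = c.
Proof.
rewrite [LHS](@integral_cst _ _ _ P setT measurableT c).
by rewrite -[RHS]mule1; congr (_ * _); exact: probability_setT.
Qed.

Context d1 d2 (T1 : measurableType d1) (T2 : measurableType d2) (R : realType).
Variables (P1 : probability T1 R) (P2 : probability T2 R).

Lemma ge0_integral_fst (f : T1 -> \bar R) : measurable_fun setT f ->
  (forall x, 0 <= f x) -> \int[P1 \x P2]_w f w.1 = \int[P1]_x f x.
Proof.
move=> mf f0; rewrite (fubini_tonelli1 (fun w => f w.1))//; last exact: measurableT_comp.
by apply: eq_integral => x _; rewrite /fubini_F/= integral_prob_cst.
Qed.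

Lemma ge0_integral_snd (f : T2 -> \bar R) : measurable_fun setT f ->
  (forall x, 0 <= f x) -> \int[P1 \x P2]_w f w.2 = \int[P2]_x f x.
Proof.
move=> mf f0; rewrite (fubini_tonelli2 (fun w => f w.2))//; last exact: measurableT_comp.
by apply: eq_integral => x _; rewrite /fubini_F /fubini_G/= integral_prob_cst.
Qed.

Lemma integrable_fst (f : T1 -> R) : P1.-integrable setT (EFin \o f) ->
  (P1 \x P2).-integrable setT (fun w => (f w.1)%:E).
Proof.
move=> /integrableP[mf fi]; apply/integrableP; split; first exact: (measurableT_comp mf).
rewrite (ge0_integral_fst (f := fun x => `|(f x)%:E|))//.
exact: measurableT_comp.
Qed.

Lemma integrable_snd (f : T2 -> R) : P2.-integrable setT (EFin \o f) ->
  (P1 \x P2).-integrable setT (fun w => (f w.2)%:E).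
Proof.
move=> /integrableP[mf fi]; apply/integrableP; split; first exact: (measurableT_comp mf).
rewrite (ge0_integral_snd (f := fun x => `|(f x)%:E|))//.
exact: measurableT_comp.
Qed.

Lemma integral_fst (f : T1 -> R) : P1.-integrable setT (EFin \o f) ->
  \int[P1 \x P2]_w (f w.1)%:E = \int[P1]_x (f x)%:E.
Proof.
move=> fi; rewrite -integral12_prod_meas1; last exact: integrable_fst.
by apply: eq_integral => x _; rewrite /fubini_F /fubini_G/= integral_prob_cst.
Qed.

End product_marginals.

Section gaussian_moment.
Context (R : realType).
Local Open Scope ereal_scope.
Notation gam := (normal_prob (0%R : R) (1%R : R)).

Lemma gaussian_exp_integrable (a : R) :
  gam.-integrable setT (fun z => (expR (a * z))%:E).
Proof.
have me : measurable_fun [set: R] (fun z : R => expR (a * z)).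
  by apply: measurableT_comp => //; exact: measurable_funM.
apply/integrableP; split; first exact/measurable_EFinP.
under eq_integral do rewrite gee0_abs ?lee_fin ?expR_ge0//.
have H : \int[gam]_y (expR (a * y - a ^+ 2 / 2))%:E = 1.
  rewrite -[RHS](integral_prob_cst gam 1).
  rewrite (@gaussian_shift R a (fun=> 1))//.
  by under [RHS]eq_integral do rewrite mul1e.
rewrite (_ : \int[gam]_z _ = (expR (a ^+ 2 / 2))%:E); first by rewrite ltry.
transitivity (\int[gam]_y ((expR (a ^+ 2 / 2))%:E * (expR (a * y - a ^+ 2 / 2))%:E)).
  by apply: eq_integral => y _; rewrite -EFinM -expRD addrC subrK.
rewrite ge0_integralZl ?H ?mule1 ?lee_fin ?expR_ge0//.
apply/measurable_EFinP; apply: measurableT_comp => //.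
by apply: measurable_funB => //; exact: measurable_funM.
Qed.

(** From z^2 <= 4 exp |z| <= 4 (exp z + exp (- z)). *)
Lemma gaussian_sqr_integrable : gam.-integrable setT (fun z => (z ^+ 2)%:E).
Proof.
apply: (@le_integrable _ _ _ gam setT measurableT _
  (fun z => 4%:E * ((expR (1 * z))%:E + (expR (-1 * z))%:E))).
- by apply/measurable_EFinP; exact: measurable_funX.
- move=> z _; rewrite -EFinD -EFinM !abse_EFin lee_fin ger0_norm ?sqr_ge0//.
  apply: le_trans (ler_norm _).
  rewrite mul1r mulN1r.
  have H (t : R) : (0 <= t -> t ^+ 2 <= 4 * expR t)%R.
    move=> t0; have := expR_ge1Dx (t / 2).
    have -> : (expR t = expR (t / 2) ^+ 2)%R.
      by rewrite expr2 -expRD; congr expR; field.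
    have := expR_gt0 (t / 2); nra.
  have [z0|z0] := leP 0%R z.
    by have := H _ z0; have := expR_gt0 (- z); lra.
  have := H (- z)%R; rewrite oppr_ge0 (ltW z0) sqrrN => /(_ isT).
  by have := expR_gt0 z; lra.
- apply: integrableZl => //; apply: integrableD => //; exact: gaussian_exp_integrable.
Qed.
End gaussian_moment.

(** * Likelihood ratios of the Gaussian channel *)

Section likelihood.
Context (R : realType).
Variable pi : probability (measurableTypeR R) R.
Hypothesis pi_int1 : pi.-integrable setT (fun x => x%:E).
Hypothesis pi_int2 : pi.-integrable setT (fun x => (x ^+ 2)%:E).
Hypothesis pi_mean0 : (\int[pi]_x x%:E = 0)%E.
Hypothesis pi_var1 : (\int[pi]_x (x ^+ 2)%:E = 1)%E.
Notation gam := (normal_prob (0 : R) (1 : R)).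

(** Likelihood ratio at the output y between the input x and the input 0. *)
Definition lr (s x y : R) : R := expR (Num.sqrt s * x * y - s * x ^+ 2 / 2).

(** Density of the output law with respect to the standard Gaussian measure. *)
Definition mlr (s y : R) : R := (\int[pi]_x lr s x y)%R.
Definition mlr1 (s y : R) : R := (\int[pi]_x (x * lr s x y))%R.
Definition post_mean (s y : R) : R := mlr1 s y / mlr s y.

Lemma lr_gt0 s x y : 0 < lr s x y. Proof. exact: expR_gt0. Qed.

Lemma lr_le s x y : 0 <= s -> lr s x y <= expR (y ^+ 2 / 2).
Proof.
move=> s0; rewrite ler_expR; have := sqr_ge0 (Num.sqrt s * x - y).
have -> : s * x ^+ 2 = (Num.sqrt s * x) ^+ 2 by rewrite exprMn sqr_sqrtr.
nra.
Qed.

Lemma measurable_lr s :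
  measurable_fun [set: measurableTypeR R * measurableTypeR R]
    (fun w => lr s w.1 w.2).
Proof.
apply: measurableT_comp => //; apply: measurable_funB.
  apply: measurable_funM; last exact: measurable_snd.
  by apply: measurable_funM => //; exact: measurable_fst.
apply: measurable_funM => //; apply: measurable_funM => //.
by apply: measurable_funX; exact: measurable_fst.
Qed.

Lemma measurable_lr1 s y : measurable_fun [set: measurableTypeR R] (lr s ^~ y).
Proof. exact: (measurableT_comp (measurable_lr s) (measurable_pair2 y)). Qed.

Lemma integrable_mul_lr (f : R -> R) s y : 0 <= s ->
  pi.-integrable setT (fun x => (f x)%:E) ->
  pi.-integrable setT (fun x => (f x * lr s x y)%:E).
Proof.
move=> s0 fi.
apply: (@le_integrable _ _ _ pi setT measurableT _
  (fun x => (expR (y ^+ 2 / 2))%:E * (f x)%:E)%E).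
- apply/measurable_EFinP; apply: measurable_funM; last exact: measurable_lr1.
  by apply/measurable_EFinP; exact: measurable_int fi.
- move=> x _; rewrite -EFinM !abse_EFin lee_fin !normrM mulrC ler_wpM2r//.
  by rewrite !ger0_norm ?expR_ge0//; exact: lr_le.
- exact: integrableZl.
Qed.

Lemma pi_int0 : pi.-integrable setT (fun x => 1%:E).
Proof. exact: finite_measure_integrable_cst. Qed.

Lemma integrable_lr s y : 0 <= s -> pi.-integrable setT (fun x => (lr s x y)%:E).
Proof.
move=> s0; apply: eq_integrable (integrable_mul_lr y s0 pi_int0) => // x _.
by rewrite mul1r.
Qed.

Lemma mlrE s y : 0 <= s -> (\int[pi]_x (lr s x y)%:E = (mlr s y)%:E)%E.
Proof. by move=> s0; rewrite /mlr /Rintegral fineK// integrable_fin_num// integrable_lr. Qed.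

Lemma mlr1E s y : 0 <= s -> (\int[pi]_x (x * lr s x y)%:E = (mlr1 s y)%:E)%E.
Proof.
by move=> s0; rewrite /mlr1 /Rintegral fineK// integrable_fin_num// integrable_mul_lr.
Qed.

(** Jensen's inequality for exp under the unnormalized weight w: integrate
exp u >= exp v (1 + u - v), where v is the w-mean of u. *)
Lemma exp_mean_le (w u : R -> R) v :
  (forall x, 0 <= w x) ->
  pi.-integrable setT (fun x => (w x)%:E) ->
  pi.-integrable setT (fun x => (w x * u x)%:E) ->
  pi.-integrable setT (fun x => (w x * expR (u x))%:E) ->
  (\int[pi]_x (w x * u x)%:E = v%:E * \int[pi]_x (w x)%:E)%E ->
  ((expR v)%:E * \int[pi]_x (w x)%:E <= \int[pi]_x (w x * expR (u x))%:E)%E.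
Proof.
move=> w0 iw iwu iwe uE.
have i1 : pi.-integrable setT
    (fun x => (expR v)%:E * ((w x)%:E + ((w x * u x)%:E - v%:E * (w x)%:E)))%E.
  apply: integrableZl => //; apply: integrableD => //; apply: integrableB => //.
  exact: integrableZl.
apply: (@le_trans _ _ (\int[pi]_x
    ((expR v)%:E * ((w x)%:E + ((w x * u x)%:E - v%:E * (w x)%:E))))%E).
  rewrite integralZl//; last first.
    by apply: integrableD => //; apply: integrableB => //; exact: integrableZl.
  rewrite integralD//; last by apply: integrableB => //; exact: integrableZl.
  rewrite integralB//; last exact: integrableZl.
  rewrite integralZl// uE subee ?adde0//.
  by rewrite fin_numM// integrable_fin_num.
apply: le_integral => // x _ /=.
rewrite -EFinM lee_fin.
rewrite (_ : expR (u x) = expR v * expR (u x - v)); last by rewrite -expRD addrC subrK.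
have := expR_ge1Dx (u x - v) => H.
rewrite mulrCA ler_wpM2l ?expR_ge0//.
have := w0 x; nra.
Qed.

(** Jensen's inequality; the exponent has mean - s/2 since the prior is centered
with unit variance. *)
Lemma mlr_ge s y : 0 <= s -> expR (- s / 2) <= mlr s y.
Proof.
move=> s0; rewrite -lee_fin -mlrE//.
have isx : pi.-integrable setT (fun x => (1 * (Num.sqrt s * x * y - s * x ^+ 2 / 2))%:E).
  have := integrableB measurableT (integrableZl measurableT (Num.sqrt s * y) pi_int1)
    (integrableZl measurableT (s / 2) pi_int2).
  apply: eq_integrable => // x _ /=; rewrite -!EFinM -EFinB; congr _%:E; ring.
have E1 : (\int[pi]_x (cst (1 : R) x)%:E = 1%:E)%E.
  exact: (integral_prob_cst pi 1%:E).
rewrite -[leLHS]mule1 -E1.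
apply: le_trans (_ : \int[pi]_x (1 * lr s x y)%:E <= _)%E; last first.
  by under eq_integral do rewrite mul1r.
apply: (@exp_mean_le (cst 1)) => //; first exact: pi_int0.
- by apply: eq_integrable (integrable_lr y s0) => // x _; rewrite mul1r.
- transitivity (\int[pi]_x ((Num.sqrt s * y)%:E * x%:E - (s / 2)%:E * (x ^+ 2)%:E))%E.
    apply: eq_integral => x _; rewrite -!EFinM -EFinB; congr _%:E; rewrite /cst; ring.
  rewrite integralB//; [|exact: integrableZl..].
  rewrite !integralZl// pi_mean0 pi_var1 E1 mule0 !mule1 sub0e -EFinN.
  by rewrite mulNr.
Qed.

Lemma mlr_gt0 s y : 0 <= s -> 0 < mlr s y.
Proof. by move=> s0; apply: lt_le_trans (mlr_ge _ s0); exact: expR_gt0. Qed.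

Lemma mlr_le s y : 0 <= s -> mlr s y <= expR (y ^+ 2 / 2).
Proof.
move=> s0; rewrite -lee_fin -mlrE//.
apply: (@le_trans _ _ (\int[pi]_x (expR (y ^+ 2 / 2))%:E)%E); last first.
  by rewrite integral_prob_cst.
apply: ge0_le_integral => //.
- by move=> x _; rewrite lee_fin ltW// lr_gt0.
- exact: measurable_int (integrable_lr y s0).
- by move=> x _; rewrite lee_fin lr_le.
Qed.

(** Quadratic growth makes ln g_s(Y_s) integrable under a second moment only. *)
Lemma ln_mlr_bound s y : 0 <= s -> `|ln (mlr s y)| <= s / 2 + y ^+ 2 / 2.
Proof.
move=> s0; have g0 := mlr_gt0 y s0.
have H1 : - s / 2 <= ln (mlr s y) by rewrite -[leLHS]expRK ler_ln ?posrE ?expR_gt0// mlr_ge.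
have H2 : ln (mlr s y) <= y ^+ 2 / 2 by rewrite -[leRHS]expRK ler_ln ?posrE ?expR_gt0// mlr_le.
by rewrite ler_norml; have := sqr_ge0 y; lra.
Qed.

(** ln g_s is a log-moment generating function, hence convex, with derivative
sqrt s times the posterior mean; this is its tangent inequality, obtained from
Jensen's inequality under the posterior at a. *)
Lemma ln_mlr_tangent s a b : 0 <= s ->
  ln (mlr s a) + Num.sqrt s * post_mean s a * (b - a) <= ln (mlr s b).
Proof.
move=> s0; have ga := mlr_gt0 a s0; have gb := mlr_gt0 b s0.
set v := Num.sqrt s * post_mean s a * (b - a).
rewrite -(expRK v) -lnM ?posrE ?expR_gt0// ler_ln ?posrE ?mulr_gt0 ?expR_gt0//.
rewrite mulrC -lee_fin EFinM -(mlrE b s0) -(mlrE a s0).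
have lrE x : lr s x a * expR (Num.sqrt s * (b - a) * x) = lr s x b.
  by rewrite /lr -expRD; congr expR; ring.
under [X in (_ <= X)%E]eq_integral do rewrite -lrE.
apply: (@exp_mean_le (lr s ^~ a)).
- by move=> x; rewrite ltW// lr_gt0.
- exact: integrable_lr.
- have := integrableZl measurableT (Num.sqrt s * (b - a)) (integrable_mul_lr a s0 pi_int1).
  apply: eq_integrable => // x _; rewrite -EFinM; congr _%:E; ring.
- by apply: eq_integrable (integrable_lr b s0) => // x _; rewrite lrE.
- transitivity (\int[pi]_x ((Num.sqrt s * (b - a))%:E * (x * lr s x a)%:E))%E.
    by apply: eq_integral => x _; rewrite -EFinM; congr _%:E; ring.
  rewrite integralZl//; last exact: integrable_mul_lr.
  rewrite mlr1E// mlrE// -!EFinM; congr _%:E.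
  by rewrite /v /post_mean; field; rewrite gt_eqF.
Qed.

Lemma measurable_mlr s : 0 <= s -> measurable_fun [set: R] (mlr s).
Proof.
move=> s0; apply/measurable_EFinP.
have := @measurable_fun_fubini_tonelli_G _ _ (measurableTypeR R) (measurableTypeR R) R pi
  (fun w => (lr s w.1 w.2)%:E).
rewrite /fubini_G/= => H.
apply: eq_measurable_fun (H _ _) => /=.
- by move=> y _; rewrite mlrE.
- by apply/measurable_EFinP; exact: measurable_lr.
- by move=> x; rewrite lee_fin ltW// lr_gt0.
Qed.

Lemma measurable_ln_mlr s : 0 <= s -> measurable_fun [set: R] (fun y => ln (mlr s y)).
Proof. by move=> s0; apply: measurableT_comp => //; exact: measurable_mlr. Qed.

End likelihood.

(** * Law of the channel and degradation of the signal-to-noise ratio *)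

Section channel.
Context (R : realType).
Variable pi : probability (measurableTypeR R) R.
Notation gam := (normal_prob (0 : R) (1 : R)).
Notation P := (channel_prob pi).
Notation RR := (measurableTypeR R * measurableTypeR R)%type.

Lemma measurable_pair_obs s :
  measurable_fun [set: RR] (fun w : RR => ((w.1, observation s w) : RR)).
Proof.
apply: measurable_fun_pair => /=; first exact: measurable_fst.
exact: measurable_observation.
Qed.

(** Conditionally on X = x this is the Gaussian shift by sqrt s x: the law of
(X, Y_s) has density [lr s] with respect to the law of (X, N). *)
Lemma ge0_channel_density s (F : RR -> \bar R) : 0 <= s ->
  measurable_fun setT F -> (forall w, 0 <= F w)%E ->
  (\int[P]_w F (w.1, observation s w) = \int[P]_w (F w * (lr s w.1 w.2)%:E))%E.
Proof.
move=> s0 mF F0.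
have mlrw : measurable_fun [set: RR] (fun w => F w * (lr s w.1 w.2)%:E)%E.
  by apply: emeasurable_funM => //; apply/measurable_EFinP; exact: measurable_lr.
have Flr0 w : (0 <= F w * (lr s w.1 w.2)%:E)%E.
  by rewrite mule_ge0// lee_fin ltW// lr_gt0.
rewrite (fubini_tonelli1 (fun w : RR => F (w.1, observation s w)))//; last first.
  exact: (measurableT_comp mF (measurable_pair_obs s)).
rewrite fubini_tonelli1//.
apply: eq_integral => x _; rewrite /fubini_F/= /observation /signal /noise/=.
have mFx : measurable_fun [set: R] (fun y => F (x, y)).
  exact: (measurableT_comp mF (measurable_pair1 x)).
rewrite (gaussian_shift (Num.sqrt s * x) mFx (fun y => F0 _)).
by apply: eq_integral => y _; rewrite /lr exprMn sqr_sqrtr.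
Qed.

Lemma channel_density s (F : RR -> R) : 0 <= s -> measurable_fun setT F ->
  P.-integrable setT (fun w => (F (w.1, observation s w))%:E) ->
  P.-integrable setT (fun w => (F w * lr s w.1 w.2)%:E) /\
  (\int[P]_w (F (w.1, observation s w))%:E =
   \int[P]_w (F w * lr s w.1 w.2)%:E)%E.
Proof.
move=> s0 mF iF.
apply: (@integral_transfer _ _ _ RR RR RR R P P
  (fun w => (w.1, observation s w)) id (fun w => lr s w.1 w.2)) => //.
- exact: measurable_pair_obs.
- exact: measurable_lr.
- by move=> w; rewrite ltW// lr_gt0.
- by move=> G mG G0; exact: ge0_channel_density.
Qed.

Lemma ge0_observation_law s (f : R -> \bar R) : 0 <= s ->
  measurable_fun setT f -> (forall y, 0 <= f y)%E ->
  (\int[P]_w f (observation s w) = \int[gam]_y (f y * (mlr pi s y)%:E))%E.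
Proof.
move=> s0 mf f0.
have mfs : measurable_fun [set: RR] (fun w => f w.2).
  exact: (measurableT_comp mf measurable_snd).
rewrite (@ge0_channel_density s (fun w => f w.2))// fubini_tonelli2//; last 2 first.
- by apply: emeasurable_funM => //; apply/measurable_EFinP; exact: measurable_lr.
- by move=> w; rewrite mule_ge0// lee_fin ltW// lr_gt0.
apply: eq_integral => y _; rewrite /fubini_G/= ge0_integralZl//.
- by rewrite mlrE.
- by apply/measurable_EFinP; exact: measurable_lr1.
- by move=> x _; rewrite lee_fin ltW// lr_gt0.
Qed.

(** The pair (X, rho Y_s + sigma Z), where Z is an extra standard Gaussian. *)
Definition degraded (rho sigma s : R) (w : RR * measurableTypeR R) : RR :=
  (w.1.1, rho * observation s w.1 + sigma * w.2).

Lemma measurable_degraded rho sigma s : measurable_fun setT (degraded rho sigma s).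
Proof.
apply: measurable_fun_pair => /=.
  exact: (measurableT_comp measurable_fst measurable_fst).
apply: measurable_funD; apply: measurable_funM => //.
exact: (measurableT_comp (measurable_observation s) measurable_fst).
Qed.

(** For fixed X the noise rho N + sigma Z is again standard Gaussian, so a
channel of smaller signal-to-noise ratio is a noisy version of a better one. *)
Lemma ge0_degradation (s1 s2 rho sigma : R) (F : RR -> \bar R) : 0 <= s2 ->
  0 < sigma -> rho ^+ 2 + sigma ^+ 2 = 1 -> rho * Num.sqrt s2 = Num.sqrt s1 ->
  measurable_fun setT F -> (forall w, 0 <= F w)%E ->
  (\int[P \x gam]_w F (degraded rho sigma s2 w) =
   \int[P]_w F (w.1, observation s1 w))%E.
Proof.
move=> s20 sig0 rs rhos mF F0.
have mFd := measurableT_comp mF (measurable_degraded rho sigma s2).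
rewrite (fubini_tonelli1 (fun w => F (degraded rho sigma s2 w)))//.
rewrite fubini_tonelli1//; last 2 first.
- by apply: (measurable_fun_fubini_tonelli_F (fun w => F (degraded rho sigma s2 w))).
- by move=> w; apply: integral_ge0 => z _; exact: F0.
rewrite (fubini_tonelli1 (fun w : RR => F (w.1, observation s1 w)))//; last first.
  exact: (measurableT_comp mF (measurable_pair_obs s1)).
apply: eq_integral => x _.
have mG : measurable_fun [set: R] (fun u => F (x, Num.sqrt s1 * x + u)).
  apply: (measurableT_comp mF); apply: measurable_fun_pair => //.
  by apply: measurable_funD.
rewrite [RHS](_ : _ = \int[gam]_u F (x, (Num.sqrt s1 * x + u)%R))%E//.
rewrite -(gaussian_rotation sig0 rs mG (fun u => F0 _)).
apply: eq_integral => y _; rewrite /fubini_F; apply: eq_integral => z _.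
rewrite /degraded /observation/= /signal/noise/=; congr (F (_, _)).
by rewrite -rhos; ring.
Qed.

Lemma degradation (s1 s2 rho sigma : R) (F : RR -> R) : 0 <= s2 ->
  0 < sigma -> rho ^+ 2 + sigma ^+ 2 = 1 -> rho * Num.sqrt s2 = Num.sqrt s1 ->
  measurable_fun setT F ->
  P.-integrable setT (fun w => (F (w.1, observation s1 w))%:E) ->
  (P \x gam)%E.-integrable setT (fun w => (F (degraded rho sigma s2 w))%:E) /\
  (\int[P]_w (F (w.1, observation s1 w))%:E =
   \int[P \x gam]_w (F (degraded rho sigma s2 w))%:E)%E.
Proof.
move=> s20 sig0 rs rhos mF iF.
have := @integral_transfer _ _ _ RR (RR * measurableTypeR R)%type RR R P (P \x gam)%E
  (fun w => (w.1, observation s1 w)) (degraded rho sigma s2) (cst 1).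
have E1 w : (F (degraded rho sigma s2 w) * cst 1 w) = F (degraded rho sigma s2 w).
  by rewrite mulr1.
case/(_ _ _ _ _ _ F mF iF) => //.
- exact: measurable_pair_obs.
- exact: measurable_degraded.
- move=> G mG G0; rewrite -(@ge0_degradation s1 s2 rho sigma G)//.
  by apply: eq_integral => w _; rewrite mule1.
by under eq_fun do rewrite E1; move=> ? ->; split => //; under eq_integral do rewrite E1.
Qed.

Lemma degradation_coefficients (s1 s2 : R) : 0 <= s1 -> s1 < s2 ->
  exists rho, exists sigma,
  [/\ 0 < sigma, rho ^+ 2 + sigma ^+ 2 = 1 & rho * Num.sqrt s2 = Num.sqrt s1].
Proof.
move=> s10 s12; have s20 : 0 < s2 by exact: le_lt_trans s12.
have r1 : s1 / s2 < 1 by rewrite ltr_pdivrMr ?mul1r.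
have r0 : 0 <= s1 / s2 by rewrite divr_ge0// ltW.
exists (Num.sqrt (s1 / s2)), (Num.sqrt (1 - s1 / s2)); split.
- by rewrite sqrtr_gt0 subr_gt0.
- by rewrite !sqr_sqrtr ?subr_ge0 ?(ltW r1)// addrC subrK.
- by rewrite -sqrtrM// divfK// gt_eqF.
Qed.

End channel.

(** * The minimum mean-square error *)

Section mmse_facts.
Context (R : realType).
Variable pi : probability (measurableTypeR R) R.
Hypothesis pi_int1 : pi.-integrable setT (fun x => x%:E).
Hypothesis pi_int2 : pi.-integrable setT (fun x => (x ^+ 2)%:E).
Hypothesis pi_mean0 : (\int[pi]_x x%:E = 0)%E.
Hypothesis pi_var1 : (\int[pi]_x (x ^+ 2)%:E = 1)%E.
Notation gam := (normal_prob (0 : R) (1 : R)).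
Notation P := (channel_prob pi).
Notation RR := (measurableTypeR R * measurableTypeR R)%type.

Lemma integrable_signal : P.-integrable setT (fun w => (w.1)%:E).
Proof. exact: (integrable_fst _ pi_int1). Qed.

Lemma integrable_signal2 : P.-integrable setT (fun w => (w.1 ^+ 2)%:E).
Proof.
by apply: (@integrable_fst _ _ (measurableTypeR R) (measurableTypeR R) R pi gam
  (fun x : R => x ^+ 2)).
Qed.

Lemma integrable_noise2 : P.-integrable setT (fun w => (w.2 ^+ 2)%:E).
Proof.
by apply: (@integrable_snd _ _ (measurableTypeR R) (measurableTypeR R) R pi gam
  (fun x : R => x ^+ 2)); exact: gaussian_sqr_integrable.
Qed.

Lemma integral_signal2 : (\int[P]_w (w.1 ^+ 2)%:E = 1)%E.
Proof.
by rewrite (@integral_fst _ _ (measurableTypeR R) (measurableTypeR R) R pi gam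
  (fun x : R => x ^+ 2)).
Qed.

Lemma integrable_dominated (f : RR -> R) (a b c : R) :
  measurable_fun setT f ->
  (forall w, `|f w| <= a + b * w.1 ^+ 2 + c * w.2 ^+ 2) ->
  P.-integrable setT (fun w => (f w)%:E).
Proof.
move=> mf fle.
apply: (@le_integrable _ _ _ P setT measurableT _
  (fun w => (a%:E + b%:E * (w.1 ^+ 2)%:E) + c%:E * (w.2 ^+ 2)%:E)%E).
- exact/measurable_EFinP.
- move=> w _; rewrite -!EFinM -!EFinD !abse_EFin lee_fin.
  exact: le_trans (fle w) (ler_norm _).
- apply: integrableD => //; last by apply: integrableZl => //; exact: integrable_noise2.
  apply: integrableD => //; last by apply: integrableZl => //; exact: integrable_signal2.
  exact: finite_measure_integrable_cst.
Qed.

Lemma observation_sqr_le s (w : RR) : 0 <= s ->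
  observation s w ^+ 2 <= 2 * s * w.1 ^+ 2 + 2 * w.2 ^+ 2.
Proof.
move=> s0; rewrite /observation /signal /noise.
rewrite -[in leRHS](sqr_sqrtr s0); have := sqr_ge0 (Num.sqrt s * w.1 - w.2); nra.
Qed.

Lemma measurable_mlr1 s : 0 <= s -> measurable_fun [set: R] (mlr1 pi s).
Proof.
move=> s0; apply/measurable_EFinP.
pose F := fun w : RR => (w.1 * lr s w.1 w.2)%:E.
have iF : P.-integrable setT F.
  have [] := @channel_density _ pi s (fun w : RR => w.1) s0 measurable_fst integrable_signal.
  by [].
apply: eq_measurable_fun (measurable_fubini_G iF) => y _.
by rewrite /fubini_G /F/= mlr1E.
Qed.

Lemma measurable_post_mean s : 0 <= s -> measurable_fun [set: R] (post_mean pi s).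
Proof.
move=> s0.
(* 1 / g_s is measurable as exp (- ln g_s) *)
rewrite (_ : post_mean pi s = fun y => mlr1 pi s y * expR (- ln (mlr pi s y))).
  apply: measurable_funM; first exact: measurable_mlr1.
  apply: measurableT_comp => //; apply: measurableT_comp => //.
  exact: measurable_ln_mlr.
by apply/funext => y; rewrite expRN lnK// posrE mlr_gt0.
Qed.

Lemma post_mean_centered s y : 0 <= s ->
  (\int[pi]_x ((x - post_mean pi s y) * lr s x y)%:E = 0)%E.
Proof.
move=> s0.
transitivity (\int[pi]_x ((x * lr s x y)%:E - (post_mean pi s y)%:E * (lr s x y)%:E))%E.
  by apply: eq_integral => x _; rewrite -EFinM -EFinB mulrBl.
have i1 := integrable_lr pi y s0; have i2 := integrable_mul_lr y s0 pi_int1.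
rewrite integralB//; last exact: integrableZl.
rewrite integralZl// mlr1E// mlrE// -EFinM -EFinB /post_mean.
by rewrite divfK ?subrr// gt_eqF// mlr_gt0.
Qed.

Lemma integrable_centered s y : 0 <= s ->
  pi.-integrable setT (fun x => ((x - post_mean pi s y) * lr s x y)%:E).
Proof.
move=> s0; apply: integrable_mul_lr => //.
apply: eq_integrable (integrableB measurableT pi_int1
  (finite_measure_integrable_cst _ (post_mean pi s y) measurableT)) => //.
Qed.

(** Orthogonality principle: under the density of the channel, the integral
over x at fixed y vanishes by [post_mean_centered]. *)
Lemma post_mean_orthogonal s (k : R -> R) : 0 <= s -> measurable_fun setT k ->
  P.-integrable setT
    (fun w => ((w.1 - post_mean pi s (observation s w)) * k (observation s w))%:E) ->
  (\int[P]_w ((w.1 - post_mean pi s (observation s w)) * k (observation s w))%:E = 0)%E.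
Proof.
move=> s0 mk.
pose F (w : RR) := (w.1 - post_mean pi s w.2) * k w.2.
have mF : measurable_fun [set: RR] F.
  apply: measurable_funM; last exact: (measurableT_comp mk measurable_snd).
  apply: measurable_funB; first exact: measurable_fst.
  exact: (measurableT_comp (measurable_post_mean s0) measurable_snd).
move=> /(channel_density s0 mF)[iF ->].
rewrite -integral21_prod_meas1//.
transitivity (\int[gam]_y (0 : \bar R))%E; last by rewrite integral0.
apply: eq_integral => y _; rewrite /fubini_G /F/=.
transitivity (\int[pi]_x ((k y)%:E * ((x - post_mean pi s y) * lr s x y)%:E))%E.
  by apply: eq_integral => x _; rewrite -EFinM; congr _%:E; ring.
by rewrite integralZl ?post_mean_centered ?mule0//; exact: integrable_centered.
Qed.

(** Pointwise in y, (x - k)^2 >= (x - h)^2 + 2 (h - k) (x - h), and the last term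
has zero posterior mean. *)
Lemma post_mean_optimal s (k : R -> R) : 0 <= s -> measurable_fun setT k ->
  (\int[P]_w ((w.1 - post_mean pi s (observation s w)) ^+ 2)%:E <=
   \int[P]_w ((w.1 - k (observation s w)) ^+ 2)%:E)%E.
Proof.
move=> s0 mk.
have key (f : R -> R) : measurable_fun setT f ->
    (\int[P]_w ((w.1 - f (observation s w)) ^+ 2)%:E =
    \int[gam]_y \int[pi]_x ((x - f y) ^+ 2 * lr s x y)%:E)%E.
  move=> mf.
  have mF : measurable_fun [set: RR] (fun w => ((w.1 - f w.2) ^+ 2)%:E).
    apply/measurable_EFinP; apply: (measurable_funX 2).
    apply: measurable_funB; first exact: measurable_fst.
    exact: (measurableT_comp mf measurable_snd).
  rewrite (@ge0_channel_density _ pi s (fun w => ((w.1 - f w.2) ^+ 2)%:E))//; last first.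
    by move=> w; rewrite lee_fin sqr_ge0.
  rewrite fubini_tonelli2//.
  - by apply: emeasurable_funM => //; apply/measurable_EFinP; exact: measurable_lr.
  - by move=> w; rewrite mule_ge0// lee_fin ?sqr_ge0// ltW// lr_gt0.
have mI (f : R -> R) : measurable_fun setT f -> measurable_fun [set: R]
    (fun y => \int[pi]_x ((x - f y) ^+ 2 * lr s x y)%:E)%E.
  move=> mf.
  apply: (measurable_fun_fubini_tonelli_G (m1 := pi)
    (fun w : RR => ((w.1 - f w.2) ^+ 2 * lr s w.1 w.2)%:E)).
    apply/measurable_EFinP; apply: measurable_funM; last exact: measurable_lr.
    apply: (measurable_funX 2).
    apply: measurable_funB; first exact: measurable_fst.
    exact: (measurableT_comp mf measurable_snd).
  by move=> w; rewrite lee_fin mulr_ge0 ?sqr_ge0// ltW// lr_gt0.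
have mh := measurable_post_mean s0.
rewrite !key//; apply: ge0_le_integral => //; [|exact: mI|exact: mI|].
  by move=> y _; apply: integral_ge0 => x _; rewrite lee_fin mulr_ge0 ?sqr_ge0// ltW// lr_gt0.
move=> y _.
set h := post_mean pi s y.
have isq c : pi.-integrable setT (fun x => ((x - c) ^+ 2 * lr s x y)%:E).
  apply: integrable_mul_lr => //.
  have i0 := finite_measure_integrable_cst pi (c ^+ 2) measurableT.
  have := integrableD measurableT (integrableB measurableT pi_int2
    (integrableZl measurableT (2 * c) pi_int1)) i0.
  by apply: eq_integrable => // x _ /=; congr _%:E; ring.
apply: (@le_trans _ _ (\int[pi]_x (((x - h) ^+ 2 * lr s x y)%:E +
    (2 * (h - k y))%:E * ((x - h) * lr s x y)%:E))%E).
  rewrite integralD//; last by apply: integrableZl => //; exact: integrable_centered.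
  by rewrite integralZl ?post_mean_centered ?mule0 ?adde0//; exact: integrable_centered.
apply: le_integral => //.
  apply: integrableD => //.
  by apply: integrableZl => //; exact: integrable_centered.
move=> x _ /=; rewrite -EFinM -EFinD lee_fin.
by have := lr_gt0 s x y; have := sqr_ge0 (h - k y); nra.
Qed.

Lemma integral_err_le1 s : 0 <= s ->
  (\int[P]_w ((w.1 - post_mean pi s (observation s w)) ^+ 2)%:E <= 1)%E.
Proof.
move=> s0; rewrite -integral_signal2.
apply: le_trans (post_mean_optimal s0 (measurable_cst (0 : R))) _.
by under eq_integral do rewrite subr0.
Qed.

Definition mmse_fun s : R :=
  \int[P]_w ((w.1 - post_mean pi s (observation s w)) ^+ 2).

Let merr s : 0 <= s ->
  measurable_fun [set: RR] (fun w => (w.1 - post_mean pi s (observation s w))).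
Proof.
move=> s0; apply: measurable_funB; first exact: measurable_fst.
exact: (measurableT_comp (measurable_post_mean s0) (measurable_observation s)).
Qed.

Lemma integrable_err2 s : 0 <= s ->
  P.-integrable setT (fun w => ((w.1 - post_mean pi s (observation s w)) ^+ 2)%:E).
Proof.
move=> s0; apply/integrableP; split.
  by apply/measurable_EFinP; apply: (measurable_funX 2); exact: merr.
under eq_integral do rewrite gee0_abs ?lee_fin ?sqr_ge0//.
by apply: le_lt_trans (integral_err_le1 s0) _; rewrite ltry.
Qed.

Lemma mmse_funE s : 0 <= s ->
  (\int[P]_w ((w.1 - post_mean pi s (observation s w)) ^+ 2)%:E = (mmse_fun s)%:E)%E.
Proof.
by move=> s0; rewrite /mmse_fun /Rintegral fineK// integrable_fin_num// integrable_err2.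
Qed.

Lemma mmse_fun_le1 s : 0 <= s -> mmse_fun s <= 1.
Proof. by move=> s0; rewrite -lee_fin -mmse_funE// integral_err_le1. Qed.

Lemma integrable_post_mean2 s : 0 <= s ->
  P.-integrable setT (fun w => (post_mean pi s (observation s w) ^+ 2)%:E).
Proof.
move=> s0.
apply: (@le_integrable _ _ _ P setT measurableT _
  (fun w => 2%:E * ((w.1 ^+ 2)%:E + ((w.1 - post_mean pi s (observation s w)) ^+ 2)%:E))%E).
- apply/measurable_EFinP; apply: (measurable_funX 2).
  exact: (measurableT_comp (measurable_post_mean s0) (measurable_observation s)).
- move=> w _; rewrite -EFinD -EFinM !abse_EFin lee_fin ger0_norm ?sqr_ge0//.
  apply: le_trans (ler_norm _).
  set h := post_mean _ _ _; have := sqr_ge0 (2 * w.1 - h); nra.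
- apply: integrableZl => //; apply: integrableD => //; first exact: integrable_signal2.
  exact: integrable_err2.
Qed.

Lemma integrable_err_post_mean s : 0 <= s -> P.-integrable setT
  (fun w => ((w.1 - post_mean pi s (observation s w)) * post_mean pi s (observation s w))%:E).
Proof.
move=> s0.
apply: (@le_integrable _ _ _ P setT measurableT _
  (fun w => ((w.1 - post_mean pi s (observation s w)) ^+ 2)%:E +
            (post_mean pi s (observation s w) ^+ 2)%:E)%E).
- apply/measurable_EFinP; apply: measurable_funM; first exact: merr.
  exact: (measurableT_comp (measurable_post_mean s0) (measurable_observation s)).
- move=> w _; rewrite -EFinD !abse_EFin lee_fin.
  apply: le_trans (ler_norm _); rewrite ler_norml.
  set h := post_mean _ _ _; set e := w.1 - h.
  have := sqr_ge0 (e - h); have := sqr_ge0 (e + h); have := sqr_ge0 e; have := sqr_ge0 h.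
  by move=> *; apply/andP; split; nra.
- by apply: integrableD => //; [exact: integrable_err2|exact: integrable_post_mean2].
Qed.

Lemma integrable_signal_post_mean s : 0 <= s ->
  P.-integrable setT (fun w => (w.1 * post_mean pi s (observation s w))%:E).
Proof.
move=> s0; have := integrableD measurableT (integrable_err_post_mean s0)
  (integrable_post_mean2 s0).
by apply: eq_integrable => // w _; rewrite -EFinD; congr _%:E; ring.
Qed.

(** X h = X^2 - (X - h)^2 - (X - h) h, and the last term has zero mean by
orthogonality. *)
Lemma integral_signal_post_mean s : 0 <= s ->
  (\int[P]_w (w.1 * post_mean pi s (observation s w))%:E = (1 - mmse_fun s)%:E)%E.
Proof.
move=> s0.
have i1 := integrable_signal2; have i2 := integrable_err2 s0.
have i3 := integrable_err_post_mean s0.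
transitivity (\int[P]_w (((w.1 ^+ 2)%:E - ((w.1 - post_mean pi s (observation s w)) ^+ 2)%:E) -
  ((w.1 - post_mean pi s (observation s w)) * post_mean pi s (observation s w))%:E))%E.
  by apply: eq_integral => w _; rewrite -!EFinB; congr _%:E; ring.
rewrite integralB//; last exact: integrableB.
rewrite integralB// integral_signal2 mmse_funE//.
rewrite (post_mean_orthogonal s0 (measurable_post_mean s0))//.
by rewrite sube0.
Qed.

(** For every value z of the extra noise, y |-> h_s1(rho y + sigma z) is an
estimator from Y_s2, so its error is at least M(s2); average over z. *)
Lemma mmse_fun_nonincreasing (s1 s2 : R) : 0 <= s1 -> s1 < s2 ->
  mmse_fun s2 <= mmse_fun s1.
Proof.
move=> s10 s12; have s20 : 0 <= s2 by exact: ltW (le_lt_trans s10 s12).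
have [rho [sigma [sig0 rs rhos]]] := degradation_coefficients s10 s12.
have mh := measurable_post_mean s10.
pose F (w : RR) : \bar R := ((w.1 - post_mean pi s1 w.2) ^+ 2)%:E.
have mF : measurable_fun setT F.
  apply/measurable_EFinP; apply: (measurable_funX 2).
  apply: measurable_funB; first exact: measurable_fst.
  exact: (measurableT_comp mh measurable_snd).
have F0 w : (0 <= F w)%E by rewrite lee_fin sqr_ge0.
have mFd := measurableT_comp mF (measurable_degraded rho sigma s2).
rewrite -lee_fin.
rewrite -[X in (X <= _)%E](mmse_funE s20).
rewrite -[X in (_ <= X)%E](mmse_funE s10).
rewrite -[X in (_ <= X)%E](ge0_degradation pi s20 sig0 rs rhos mF F0).
rewrite (fubini_tonelli2 (fun w => F (degraded rho sigma s2 w)))//.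
rewrite -[leLHS](integral_prob_cst gam).
apply: ge0_le_integral.
- exact: measurableT.
- by move=> z _; apply: integral_ge0 => w _; rewrite lee_fin sqr_ge0.
- exact: measurable_cst.
- exact: (measurable_fun_fubini_tonelli_G (m1 := P) (fun w => F (degraded rho sigma s2 w))).
move=> z _.
apply: (@post_mean_optimal s2 (fun y => post_mean pi s1 (rho * y + sigma * z)) s20).
by apply: (measurableT_comp mh); apply: measurable_funD.
Qed.

Lemma mmse_fun_le (s1 s2 : R) : 0 <= s1 -> s1 <= s2 -> mmse_fun s2 <= mmse_fun s1.
Proof.
by move=> s10; rewrite le_eqVlt => /predU1P[->//|]; exact: mmse_fun_nonincreasing.
Qed.

End mmse_facts.

(** * Divergence of the output and mutual information *)

Section information_facts.
Context (R : realType).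
Variable pi : probability (measurableTypeR R) R.
Hypothesis pi_int1 : pi.-integrable setT (fun x => x%:E).
Hypothesis pi_int2 : pi.-integrable setT (fun x => (x ^+ 2)%:E).
Hypothesis pi_mean0 : (\int[pi]_x x%:E = 0)%E.
Hypothesis pi_var1 : (\int[pi]_x (x ^+ 2)%:E = 1)%E.
Notation gam := (normal_prob (0 : R) (1 : R)).
Notation P := (channel_prob pi).
Notation RR := (measurableTypeR R * measurableTypeR R)%type.
Notation RRR := (measurableTypeR R * measurableTypeR R * measurableTypeR R)%type.

Let mlr_pos s y : 0 <= s -> 0 < mlr pi s y.
Proof. by move=> s0; exact: mlr_gt0. Qed.

Lemma integrable_ln_mlr_obs s : 0 <= s ->
  P.-integrable setT (fun w => (ln (mlr pi s (observation s w)))%:E).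
Proof.
move=> s0; apply: (@integrable_dominated _ _ pi_int2 _ (s / 2) s 1).
  exact: (measurableT_comp (measurable_ln_mlr pi s0) (measurable_observation s)).
move=> w; apply: le_trans (ln_mlr_bound pi_int1 pi_int2 pi_mean0 pi_var1 _ s0) _.
by have := observation_sqr_le w s0; lra.
Qed.

Lemma integrable_ln_mlr_noise s : 0 <= s ->
  P.-integrable setT (fun w => (ln (mlr pi s w.2))%:E).
Proof.
move=> s0; apply: (@integrable_dominated _ _ pi_int2 _ (s / 2) 0 (1 / 2)).
  exact: (measurableT_comp (measurable_ln_mlr pi s0) measurable_snd).
move=> w; apply: le_trans (ln_mlr_bound pi_int1 pi_int2 pi_mean0 pi_var1 _ s0) _.
lra.
Qed.

Lemma integral_mlr s : 0 <= s -> (\int[gam]_y (mlr pi s y)%:E = 1)%E.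
Proof.
move=> s0; rewrite -[RHS](integral_prob_cst P).
rewrite (@ge0_observation_law _ pi s (fun=> 1%E))//.
by apply: eq_integral => y _; rewrite mul1e.
Qed.

Definition output_kl s : R := \int[P]_w (ln (mlr pi s (observation s w))).

Lemma output_klE s : 0 <= s ->
  (\int[P]_w (ln (mlr pi s (observation s w)))%:E = (output_kl s)%:E)%E.
Proof.
by move=> s0; rewrite /output_kl /Rintegral fineK// integrable_fin_num// integrable_ln_mlr_obs.
Qed.

(** A Gaussian log-Sobolev inequality up to the constant: bound
ln g_s(Y_s) - ln g_s(N) by the tangent at Y_s. *)
Lemma output_kl_le s : 0 <= s -> output_kl s <= s * (1 - mmse_fun pi s).
Proof.
move=> s0.
have i1 := integrable_ln_mlr_obs s0; have i2 := integrable_ln_mlr_noise s0.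
have i3 := integrable_signal_post_mean pi_int1 pi_int2 pi_mean0 pi_var1 s0.
have H1 : (\int[P]_w (ln (mlr pi s w.2))%:E <= 0)%E.
  have := @gibbs_integral _ _ _ P (fun w : RR => ln (mlr pi s w.2)) (fun=> 0) i2.
  rewrite integral0; apply; first exact: integrable0.
  rewrite -[leRHS](integral_mlr s0) -[leRHS](ge0_integral_snd pi).
  - by under eq_integral do rewrite subr0 lnK ?posrE ?mlr_pos//.
  - by apply/measurable_EFinP; exact: measurable_mlr.
  - by move=> y; rewrite lee_fin ltW// mlr_pos.
rewrite -lee_fin EFinM -output_klE//.
rewrite -(integral_signal_post_mean pi_int1 pi_int2 pi_mean0 pi_var1 s0).
rewrite -integralZl//.
apply: (@le_trans _ _ (\int[P]_w (ln (mlr pi s (observation s w)))%:E -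
   \int[P]_w (ln (mlr pi s w.2))%:E)%E).
  by rewrite leeDl// leeNr oppe0.
rewrite -(integralB measurableT i1 i2).
apply: (le_integral measurableT (integrableB measurableT i1 i2) (integrableZl measurableT s i3)).
move=> w _ /=; rewrite lee_fin.
have := ln_mlr_tangent pi_int1 pi_int2 pi_mean0 pi_var1 (observation s w) w.2 s0.
rewrite {3}/observation /signal /noise.
have E1 : Num.sqrt s * Num.sqrt s = s by rewrite -expr2 sqr_sqrtr.
set h := post_mean _ _ _.
have -> : Num.sqrt s * h * (w.2 - (Num.sqrt s * w.1 + w.2)) =
  - ((Num.sqrt s * Num.sqrt s) * (w.1 * h)).
  by ring.
rewrite E1 !lerBlDr => H; rewrite [leRHS]addrC; exact: H.
Qed.

(** Gibbs' inequality for the ratio g_s1(rho Y_s2 + sigma Z) / g_s2(Y_s2), whose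
mean is the integral of g_s1 against the standard Gaussian measure. *)
Lemma output_kl_nondecreasing (s1 s2 : R) : 0 <= s1 -> s1 <= s2 ->
  output_kl s1 <= output_kl s2.
Proof.
move=> s10; rewrite le_eqVlt => /predU1P[->//|s12].
have s20 : 0 <= s2 by exact: ltW (le_lt_trans s10 s12).
have [rho [sigma [sig0 rs rhos]]] := degradation_coefficients s10 s12.
have ml1 := measurable_ln_mlr pi s10.
pose F (w : RR) : R := ln (mlr pi s1 w.2).
have mF : measurable_fun setT F by exact: (measurableT_comp ml1 measurable_snd).
have [iF E1] := degradation s20 sig0 rs rhos mF (integrable_ln_mlr_obs s10).
have E2 := integral_fst gam (integrable_ln_mlr_obs s20).
have i2 := integrable_fst gam (integrable_ln_mlr_obs s20).
rewrite -lee_fin -[X in (X <= _)%E](output_klE s10) -[X in (_ <= X)%E](output_klE s20).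
rewrite -[leRHS]E2 [leLHS]E1.
apply: (gibbs_integral iF i2).
pose G (v : measurableTypeR R * measurableTypeR R) : \bar R :=
  (mlr pi s1 (rho * v.1 + sigma * v.2) / mlr pi s2 v.1)%:E.
have GE (v : RR) : G v =
    (expR (ln (mlr pi s1 (rho * v.1 + sigma * v.2)) - ln (mlr pi s2 v.1)))%:E.
  by rewrite expRD expRN !lnK ?posrE; [|exact: mlr_pos..].
have mu : measurable_fun [set: RR] (fun v : RR => rho * v.1 + sigma * v.2).
  by apply: measurable_funD; apply: measurable_funM.
have mG : measurable_fun setT G.
  rewrite (funext GE).
  apply/measurable_EFinP; apply: measurableT_comp => //; apply: measurable_funB.
    exact: (measurableT_comp ml1 mu).
  exact: (measurableT_comp (measurable_ln_mlr pi s20) measurable_fst).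
have G0 v : (0 <= G v)%E by rewrite lee_fin divr_ge0// ltW// mlr_pos.
have mo : measurable_fun [set: RRR] (fun w : RRR => ((observation s2 w.1, w.2) : RR)).
  apply: measurable_fun_pair; last exact: measurable_snd.
  exact: (measurableT_comp (measurable_observation s2) measurable_fst).
rewrite (_ : \int[_]_w _ = \int[(P \x gam)%E]_w G (observation s2 w.1, w.2))%E; last first.
  by apply: eq_integral => w _; rewrite GE.
rewrite (fubini_tonelli1 (fun w : RRR => G (observation s2 w.1, w.2))
  (measurableT_comp mG mo) (fun w => G0 _)).
rewrite /fubini_F/=.
rewrite (@ge0_observation_law _ pi s2 (fun y => \int[gam]_z G (y, z))%E)//; last 2 first.
- exact: (measurable_fun_fubini_tonelli_F G mG G0).
- by move=> y; apply: integral_ge0.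
have mm1 : measurable_fun [set: R] (fun y => (mlr pi s1 y)%:E).
  by apply/measurable_EFinP; exact: measurable_mlr.
have m10 y : (0 <= (mlr pi s1 y)%:E)%E by rewrite lee_fin ltW// mlr_pos.
rewrite -[leRHS](integral_mlr s10) -(gaussian_rotation sig0 rs mm1)//.
rewrite le_eqVlt; apply/orP; left; apply/eqP; apply: eq_integral => y _.
rewrite -ge0_integralZr//.
- apply: eq_integral => z _; rewrite /G/= -EFinM divfK// gt_eqF//.
  exact: mlr_pos.
- exact: (measurableT_comp mG (measurable_pair1 y)).
- by rewrite lee_fin ltW// mlr_pos.
Qed.

(** Logarithm of the density of the joint law of (X, Y_s) with respect to the
product of its marginals. *)
Definition info_density s (w : RR) : R := ln (lr s w.1 w.2) - ln (mlr pi s w.2).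

Lemma measurable_info_density s : 0 <= s -> measurable_fun setT (info_density s).
Proof.
move=> s0; apply: measurable_funB.
  by apply: measurableT_comp => //; exact: measurable_lr.
exact: (measurableT_comp (measurable_ln_mlr pi s0) measurable_snd).
Qed.

Lemma info_densityE s (w : RR) : 0 <= s ->
  expR (info_density s w) = lr s w.1 w.2 / mlr pi s w.2.
Proof. by move=> s0; rewrite expRD expRN !lnK// posrE ?mlr_pos ?lr_gt0. Qed.

Lemma integrable_signal_noise : P.-integrable setT (fun w => (w.1 * w.2)%:E).
Proof.
apply: (@integrable_dominated _ _ pi_int2 _ 0 1 1).
  by apply: measurable_funM; [exact: measurable_fst|exact: measurable_snd].
move=> w; rewrite ler_norml; have := sqr_ge0 (w.1 - w.2); have := sqr_ge0 (w.1 + w.2).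
have := sqr_ge0 w.1; have := sqr_ge0 w.2.
by move=> *; apply/andP; split; nra.
Qed.

Lemma integral_signal_noise : (\int[P]_w (w.1 * w.2)%:E = 0)%E.
Proof.
rewrite -integral21_prod_meas1; last exact: integrable_signal_noise.
rewrite -[RHS](integral_prob_cst gam); apply: eq_integral => z _.
rewrite /fubini_G/=; under eq_integral do rewrite EFinM.
by rewrite integralZr// pi_mean0 mul0e.
Qed.

Lemma ln_lr_obs s (w : RR) : 0 <= s ->
  ln (lr s w.1 (observation s w)) = s / 2 * w.1 ^+ 2 + Num.sqrt s * (w.1 * w.2).
Proof.
move=> s0; rewrite expRK /observation /signal /noise.
rewrite -[in X in _ - X](sqr_sqrtr s0) -[in X in _ = X / 2 * _ + _](sqr_sqrtr s0).
by field.
Qed.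

Lemma integrable_ln_lr_obs s : 0 <= s ->
  P.-integrable setT (fun w => (ln (lr s w.1 (observation s w)))%:E).
Proof.
move=> s0.
have i1 := integrableZl measurableT (s / 2) (integrable_signal2 pi_int2).
have i2 := integrableZl measurableT (Num.sqrt s) integrable_signal_noise.
by apply: eq_integrable (integrableD measurableT i1 i2) => // w _; rewrite ln_lr_obs.
Qed.

Lemma integral_ln_lr_obs s : 0 <= s ->
  (\int[P]_w (ln (lr s w.1 (observation s w)))%:E = (s / 2)%:E)%E.
Proof.
move=> s0; have i1 := integrable_signal2 pi_int2; have i2 := integrable_signal_noise.
transitivity (\int[P]_w ((s / 2)%:E * (w.1 ^+ 2)%:E + (Num.sqrt s)%:E * (w.1 * w.2)%:E))%E.
  by apply: eq_integral => w _; rewrite ln_lr_obs.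
rewrite integralD//; [|exact: integrableZl..].
rewrite !integralZl// integral_signal2// integral_signal_noise.
by rewrite mule1 mule0 adde0.
Qed.

Lemma integrable_info_density s : 0 <= s ->
  P.-integrable setT (fun w => (info_density s (w.1, observation s w))%:E).
Proof.
move=> s0.
exact: (integrableB measurableT (integrable_ln_lr_obs s0) (integrable_ln_mlr_obs s0)).
Qed.

Definition info s : R := s / 2 - output_kl s.

Lemma integral_info_density s : 0 <= s ->
  (\int[P]_w (info_density s (w.1, observation s w))%:E = (info s)%:E)%E.
Proof.
move=> s0; have i1 := integrable_ln_lr_obs s0; have i2 := integrable_ln_mlr_obs s0.
rewrite (_ : \int[_]_w _ = \int[P]_w ((ln (lr s w.1 (observation s w)))%:E -
  (ln (mlr pi s (observation s w)))%:E))%E//.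
by rewrite integralB// integral_ln_lr_obs// output_klE.
Qed.

(** Gibbs' inequality for the ratio of the densities at (X, rho Y_s2 + sigma Z)
and at (X, Y_s2): for each value of Z its mean is computed by integrating x
first, which cancels g_s1, and leaves the integral of g_s2. *)
Lemma info_nondecreasing (s1 s2 : R) : 0 <= s1 -> s1 <= s2 -> info s1 <= info s2.
Proof.
move=> s10; rewrite le_eqVlt => /predU1P[->//|s12].
have s20 : 0 <= s2 by exact: ltW (le_lt_trans s10 s12).
have [rho [sigma [sig0 rs rhos]]] := degradation_coefficients s10 s12.
have mF := measurable_info_density s10.
have [iF E1] := degradation s20 sig0 rs rhos mF (integrable_info_density s10).
have E2 := integral_fst gam (integrable_info_density s20).
have i2 := integrable_fst gam (integrable_info_density s20).
rewrite -lee_fin -[X in (X <= _)%E](integral_info_density s10).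
rewrite -[X in (_ <= X)%E](integral_info_density s20).
rewrite -[leRHS]E2 [leLHS]E1.
apply: (gibbs_integral iF i2).
pose G z (w : RR) : \bar R :=
  (expR (info_density s1 (w.1, rho * w.2 + sigma * z)) * expR (- info_density s2 w))%:E.
have mu : measurable_fun [set: RR * measurableTypeR R]
    (fun v : RR * measurableTypeR R => ((v.1.1, rho * v.1.2 + sigma * v.2) : RR)).
  apply: measurable_fun_pair; first exact: (measurableT_comp measurable_fst measurable_fst).
  apply: measurable_funD; apply: measurable_funM => //.
  exact: (measurableT_comp measurable_snd measurable_fst).
have mG : measurable_fun [set: RR * measurableTypeR R]
    (fun v : RR * measurableTypeR R => G v.2 v.1).
  apply/measurable_EFinP; apply: measurable_funM.
    exact: (measurableT_comp (@measurable_expR R) (measurableT_comp mF mu)).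
  apply: (measurableT_comp (@measurable_expR R)); apply: measurable_funN.
  exact: (measurableT_comp (measurable_info_density s20) measurable_fst).
have G0 z w : (0 <= G z w)%E by rewrite lee_fin mulr_ge0// expR_ge0.
have mo : measurable_fun [set: RRR] 
    (fun w : RRR => (((w.1.1, observation s2 w.1), w.2) : RR * measurableTypeR R)).
  apply: measurable_fun_pair; last exact: measurable_snd.
  exact: (measurableT_comp (measurable_pair_obs s2) measurable_fst).
rewrite (_ : \int[_]_w _ = \int[(P \x gam)%E]_w G w.2 (w.1.1, observation s2 w.1))%E; last first.
  by apply: eq_integral => w _; rewrite /G -expRD.
(* integrate the extra noise last *)
rewrite (fubini_tonelli2 (fun w : RRR => G w.2 (w.1.1, observation s2 w.1))
  (measurableT_comp mG mo) (fun w => G0 _ _)).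
rewrite -[leRHS](integral_prob_cst gam).
rewrite le_eqVlt; apply/orP; left; apply/eqP; apply: eq_integral => z _.
rewrite /fubini_G/=.
have mGz : measurable_fun setT (G z).
  exact: (measurableT_comp mG (measurable_pair2 z)).
rewrite (ge0_channel_density pi s20 mGz (G0 z)) fubini_tonelli2; last 2 first.
- by apply: emeasurable_funM => //; apply/measurable_EFinP; exact: measurable_lr.
- by move=> w; rewrite mule_ge0// lee_fin ltW// lr_gt0.
rewrite -[RHS](integral_mlr s20); apply: eq_integral => y _.
rewrite /fubini_G.
set u := rho * y + sigma * z.
transitivity (\int[pi]_x ((mlr pi s2 y / mlr pi s1 u)%:E * (lr s1 x u)%:E))%E.
  apply: eq_integral => x _; rewrite /G -!EFinM; congr _%:E.
  rewrite expRN !info_densityE//=; field.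
  by rewrite !gt_eqF// ?mlr_pos ?lr_gt0.
rewrite integralZl//; last exact: integrable_lr.
by rewrite mlrE// -EFinM divfK// gt_eqF// mlr_pos.
Qed.

End information_facts.

(** * Identification of the MMSE function *)

Section conditional_expectation.
Context d (T : measurableType d) (R : realType) (P : probability T R).
Variables X Y : {RV P >-> measurableTypeR R}.

Let sigma_measurable (Z : T -> R) :
  (forall B : set (measurableTypeR R), measurable B ->
     g_sigma_algebra_preimage Y (Z @^-1` B)) ->
  measurable_fun [set: g_sigma_algebra_preimageType Y] Z.
Proof. by move=> mZ _ B mB; rewrite setTI; exact: mZ. Qed.

Let cond_expectation_le (Z1 Z2 : T -> R) :
  is_cond_expectation X Y Z1 -> is_cond_expectation X Y Z2 ->
  {ae P, forall w, Z2 w <= Z1 w}.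
Proof.
move=> [mZ1 iZ1 eZ1] [mZ2 iZ2 eZ2].
pose A := [set w | Z1 w < Z2 w].
have sA : g_sigma_algebra_preimage Y A.
  have mtrue : measurable [set true] by [].
  rewrite (_ : A = (fun w => Z1 w < Z2 w) @^-1` [set true]); last first.
    by apply/seteqP; split => w /= => [->|].
  rewrite -[X in g_sigma_algebra_preimage _ X]setTI.
  exact: (measurable_fun_ltr (sigma_measurable mZ1) (sigma_measurable mZ2)
    measurableT mtrue).
have mA : measurable A.
  have [B mB <-] := sA; rewrite setTI -[X in measurable X]setTI; exact: (measurable_funP Y).
have i1 : P.-integrable A (EFin \o Z1) by exact: integrableS iZ1.
have i2 : P.-integrable A (EFin \o Z2) by exact: integrableS iZ2.
have : (\int[P]_(w in A) `|(Z2 w - Z1 w)%:E| = 0)%E.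
  transitivity (\int[P]_(w in A) ((Z2 w)%:E - (Z1 w)%:E))%E.
    apply: eq_integral => w; rewrite inE /A/= => Aw.
    by rewrite ger0_norm// subr_ge0 ltW.
  rewrite (integralB mA i2 i1).
  by rewrite /comp/= (eZ1 _ sA) (eZ2 _ sA) -(eZ1 _ sA) subee// integrable_fin_num.
have mZ21 : measurable_fun A (fun w => (Z2 w - Z1 w)%:E).
  exact: (emeasurable_funB (measurable_int _ i2) (measurable_int _ i1)).
move/(ae_eq_integral_abs P mA mZ21).
apply: filterS => w Aw; rewrite leNgt; apply/negP => lt12.
by have /= [] := Aw lt12 => /eqP; rewrite subr_eq0 => /eqP E; move: lt12; rewrite E ltxx.
Qed.

(** On {Z1 < Z2}, which belongs to the sigma-algebra of Y, the nonnegative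
function Z2 - Z1 has zero integral. *)
Lemma cond_expectation_unique (Z1 Z2 : T -> R) :
  is_cond_expectation X Y Z1 -> is_cond_expectation X Y Z2 ->
  {ae P, forall w, Z1 w = Z2 w}.
Proof.
move=> c1 c2; have := cond_expectation_le c1 c2; have := cond_expectation_le c2 c1.
by apply: filterS2 => w h1 h2; apply/eqP; rewrite eq_le h1.
Qed.

Lemma mmseE (Z : T -> R) : is_cond_expectation X Y Z ->
  mmse X Y = (\int[P]_w ((X w - Z w) ^+ 2)%:E)%E.
Proof.
move=> cZ; have cW : is_cond_expectation X Y (cond_expectation X Y).
  by rewrite /cond_expectation; case: xgetP => [W -> //|/(_ Z)].
have mW V : is_cond_expectation X Y V ->
    measurable_fun setT (fun w => ((X w - V w) ^+ 2)%:E).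
  move=> [_ iV _]; apply/measurable_EFinP; apply: (measurable_funX 2).
  apply: measurable_funB; first exact: (measurable_funP X).
  by apply/measurable_EFinP; exact: measurable_int iV.
rewrite /mmse unlock.
apply: ae_eq_integral; [exact: measurableT|exact: (mW _ cW)|exact: (mW _ cZ)|].
by apply: filterS (cond_expectation_unique cW cZ) => w ->.
Qed.
End conditional_expectation.

Section sl_mmse_value.
Context (R : realType).
Variable pi : probability (measurableTypeR R) R.
Hypothesis pi_int1 : pi.-integrable setT (fun x => x%:E).
Hypothesis pi_int2 : pi.-integrable setT (fun x => (x ^+ 2)%:E).
Hypothesis pi_mean0 : (\int[pi]_x x%:E = 0)%E.
Hypothesis pi_var1 : (\int[pi]_x (x ^+ 2)%:E = 1)%E.
Notation P := (channel_prob pi).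
Notation RR := (measurableTypeR R * measurableTypeR R)%type.

Lemma post_mean_cond_expectation s : 0 <= s ->
  @is_cond_expectation _ _ R P (@signal R) (observation s)
    (fun w => post_mean pi s (observation s w)).
Proof.
move=> s0; have mh := measurable_post_mean pi_int1 pi_int2 pi_mean0 pi_var1 s0.
have mhs := measurableT_comp mh (measurable_observation s).
have ih : P.-integrable setT (fun w => (post_mean pi s (observation s w))%:E).
  apply: (@le_integrable _ _ _ P setT measurableT _
    (fun w => 1%:E + (post_mean pi s (observation s w) ^+ 2)%:E)%E).
  - exact/measurable_EFinP.
  - move=> w _; rewrite -EFinD !abse_EFin lee_fin.
    apply: le_trans (ler_norm _); rewrite ler_norml.
    set h := post_mean _ _ _; have := sqr_ge0 (h - 1); have := sqr_ge0 (h + 1).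
    by move=> *; apply/andP; split; nra.
  - apply: integrableD => //; first exact: finite_measure_integrable_cst.
    exact: integrable_post_mean2.
split => //.
- move=> B mB; exists (post_mean pi s @^-1` B); last by rewrite setTI.
  by rewrite -[X in measurable X]setTI; exact: mh.
- move=> _ [C mC <-]; rewrite setTI.
  have mA : measurable (observation s @^-1` C).
    rewrite -[X in measurable X]setTI; exact: measurable_observation.
  pose k : R -> R := \1_C.
  have mk : measurable_fun [set: measurableTypeR R] k by exact: measurable_indic.
  have i1 : P.-integrable (observation s @^-1` C) (fun w => (w.1)%:E).
    by apply: integrableS (integrable_signal pi_int1).
  have i2 : P.-integrable (observation s @^-1` C)
      (fun w => (post_mean pi s (observation s w))%:E).
    by apply: integrableS ih.
  have ikE (w : RR) : ((w.1 - post_mean pi s (observation s w)) * k (observation s w))%:E =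
     ((fun w : RR => (w.1 - post_mean pi s (observation s w))%:E) \_ (observation s @^-1` C)) w.
    rewrite /k patchE indicE; case: ifPn => h.
      by rewrite mem_set ?mulr1//; rewrite inE in h.
    by rewrite memNset ?mulr0// => h'; move/negP: h; apply; rewrite inE.
  have id : P.-integrable setT (fun w : RR => (w.1 - post_mean pi s (observation s w))%:E).
    exact: (integrableB measurableT (integrable_signal pi_int1) ih).
  have ik : P.-integrable setT
      (fun w => ((w.1 - post_mean pi s (observation s w)) * k (observation s w))%:E).
    under eq_fun do rewrite ikE.
    by apply/(integrable_mkcond _ mA); exact: integrableS id.
  have H : (\int[P]_(w in observation s @^-1` C) (w.1)%:E -
      \int[P]_(w in observation s @^-1` C) (post_mean pi s (observation s w))%:E = 0)%E.
    rewrite -(integralB mA i1 i2).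
    rewrite -[RHS](post_mean_orthogonal pi_int1 pi_int2 pi_mean0 pi_var1 s0 mk ik).
    by under [RHS]eq_integral do rewrite ikE; rewrite -integral_mkcond.
  move/eqP: H; rewrite sube_eq//.
  - by rewrite add0e => /eqP H; exact: esym.
  - exact: integrable_fin_num.
Qed.

Lemma sl_mmseE s : 0 <= s -> sl_mmse pi s = (mmse_fun pi s)%:E.
Proof.
move=> s0; rewrite /sl_mmse (mmseE (post_mean_cond_expectation s0)).
exact: mmse_funE.
Qed.

End sl_mmse_value.

(** * Identification of the mutual information *)

Section kl_density.
Context d (T : measurableType d) (R : realType).
Local Open Scope ereal_scope.
Local Open Scope charge_scope.

Lemma measurable_lne_fin (f : T -> \bar R) : measurable_fun setT f ->
  (forall x, f x \is a fin_num) -> measurable_fun setT (fun x => lne (f x)).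
Proof.
move=> mf ff.
have mff : measurable_fun setT (fun x => fine (f x)).
  exact: measurableT_comp.
rewrite (_ : (fun x => _) = 
    (fun x => if (fine (f x) <= 0)%R then -oo else (ln (fine (f x)))%:E)).
  apply: measurable_fun_ifT => //.
    exact: measurable_fun_ler.
  by apply/measurable_EFinP; apply: measurableT_comp.
by apply/funext => x; rewrite -[in LHS](fineK (ff x)).
Qed.

(** The Radon-Nikodym derivative is almost everywhere equal to any density; the
latter being positive, the extended logarithm is an ordinary one. *)
Lemma kl_divergence_density (nu mu : probability T R) (q : T -> R) :
  measurable_fun setT q -> (forall x, 0 < q x)%R ->
  (forall A, measurable A -> nu A = \int[mu]_(x in A) (q x)%:E) ->
  kl_divergence nu mu = \int[nu]_x (ln (q x))%:E.
Proof.
move=> mq q0 nuE.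
have numu : nu `<< mu by exact: density_dominates mq nuE.
have iq := density_integrable mq (fun x => ltW (q0 x)) nuE.
rewrite /kl_divergence asboolT//.
set rn := 'd _ '/d _.
have irn : mu.-integrable setT rn by exact: Radon_Nikodym_integrable.
have mrn : measurable_fun setT rn by exact: measurable_int irn.
have rnq : {ae mu, forall x, setT x -> rn x = (q x)%:E}.
  apply: (integral_ae_eq measurableT irn); first exact/measurable_EFinP.
  move=> E _ mE; rewrite -(nuE _ mE); apply/esym.
  exact: (Radon_Nikodym_integral (nu := charge_of_finite_measure nu) numu mE).
have rnq' : {ae nu, forall x, setT x -> rn x = (q x)%:E}.
  case: rnq => N [mN N0 sN]; exists N; split => //.
  by move/null_content_dominatesP : numu; apply.
apply: ae_eq_integral => //.
- by apply: measurable_lne_fin => // x; exact: Radon_Nikodym_fin_num.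
- by apply/measurable_EFinP; apply: measurableT_comp.
- apply: filterS rnq' => x + xT; move=> /(_ xT) ->.
  by rewrite lne_EFin.
Qed.
End kl_density.

Section sl_information_value.
Context (R : realType).
Variable pi : probability (measurableTypeR R) R.
Hypothesis pi_int1 : pi.-integrable setT (fun x => x%:E).
Hypothesis pi_int2 : pi.-integrable setT (fun x => (x ^+ 2)%:E).
Hypothesis pi_mean0 : (\int[pi]_x x%:E = 0)%E.
Hypothesis pi_var1 : (\int[pi]_x (x ^+ 2)%:E = 1)%E.
Notation P := (channel_prob pi).
Notation gam := (normal_prob (0 : R) (1 : R)).
Notation RR := (measurableTypeR R * measurableTypeR R)%type.

Let mlr_pos s y : 0 <= s -> 0 < mlr pi s y.
Proof. by move=> s0; exact: mlr_gt0. Qed.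

Lemma joint_law_density s (A : set RR) : 0 <= s -> measurable A ->
  (distribution P (pair_rv (P := P) (@signal R) (observation s)) A =
  \int[(distribution P (@signal R) \x distribution P (observation s))%E]_(w in A)
    (expR (info_density pi s w))%:E)%E.
Proof.
move=> s0 mA.
have mid := measurable_info_density pi s0.
pose F (w : RR) : \bar R := (\1_A w * expR (info_density pi s w))%:E.
have mF : measurable_fun setT F.
  apply/measurable_EFinP; apply: measurable_funM; first exact: measurable_indic.
  exact: (measurableT_comp (@measurable_expR R) mid).
have F0 w : (0 <= F w)%E by rewrite lee_fin mulr_ge0 ?expR_ge0.
transitivity (\int[(distribution P (@signal R) \x
    distribution P (observation s))%E]_w F w)%E; last first.
  rewrite [RHS]integral_mkcond; apply: eq_integral => w _; rewrite patchE /F indicE.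
  by case: ifPn => _; rewrite ?mul1r ?mul0r.
rewrite fubini_tonelli1//.
rewrite (@ge0_integral_distribution _ _ _ _ _ P (@signal R)); last 2 first.
- exact: measurable_fun_fubini_tonelli_F.
- by move=> x; apply: integral_ge0 => y _; exact: F0.
rewrite [RHS](_ : _ = \int[P]_w fubini_F (distribution P (observation s)) F w.1)%E//.
rewrite (ge0_integral_fst pi gam); last 2 first.
- exact: measurable_fun_fubini_tonelli_F.
- by move=> x; apply: integral_ge0 => y _; exact: F0.
transitivity (\int[pi]_x \int[gam]_y (\1_A (x, y) * lr s x y)%:E)%E; last first.
  apply: eq_integral => x _; rewrite /fubini_F.
  have mFx : measurable_fun setT (fun y => F (x, y)).
    exact: (measurableT_comp mF (measurable_pair1 x)).
  rewrite (@ge0_integral_distribution _ _ _ _ _ P (observation s))//.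
  rewrite (@ge0_observation_law _ pi s (fun y => F (x, y)))//.
  apply: eq_integral => y _; rewrite /F -EFinM info_densityE// -mulrA; congr (_ * _)%:E.
  by rewrite divfK// gt_eqF// mlr_pos.
have m1 : measurable_fun setT (fun w : RR => (\1_A w)%:E : \bar R).
  by apply/measurable_EFinP; exact: measurable_indic.
rewrite -(fubini_tonelli1 (m1 := pi) (m2 := gam)
  (fun w : RR => (\1_A w * lr s w.1 w.2)%:E)); last 2 first.
- apply/measurable_EFinP; apply: measurable_funM.
    exact: measurable_indic.
  exact: measurable_lr.
- by move=> w; rewrite lee_fin mulr_ge0// ltW// lr_gt0.
rewrite -(@ge0_channel_density _ pi s (fun w => (\1_A w)%:E) s0 m1); last first.
  by move=> w; rewrite lee_fin.
rewrite (_ : \int[_]_w _ =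
  \int[P]_w (\1_((fun w => (w.1, observation s w)) @^-1` A) w)%:E)%E//.
have mpre : measurable ((fun w : RR => (w.1, observation s w)) @^-1` A).
  by rewrite -[X in measurable X]setTI; exact: measurable_pair_obs.
by rewrite (integral_indic _ measurableT mpre) setIT.
Qed.

Lemma sl_mutual_informationE s : 0 <= s ->
  sl_mutual_information pi s = (info pi s)%:E.
Proof.
move=> s0.
have mid := measurable_info_density pi s0.
rewrite /sl_mutual_information /mutual_information.
rewrite (kl_divergence_density (q := fun w : RR => expR (info_density pi s w))).
- under eq_integral do rewrite expRK.
  rewrite integral_distribution.
  + exact: integral_info_density.
  + exact/measurable_EFinP.
  + exact: integrable_info_density.
- exact: (measurableT_comp (@measurable_expR R) mid).
- by move=> w; exact: expR_gt0.
- by move=> A mA; exact: joint_law_density.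
Qed.
End sl_information_value.

(** * The entropy bounds the mutual information *)

Section entropy_bound.
Context (R : realType).
Variable pi : probability (measurableTypeR R) R.
Local Open Scope ereal_scope.

(** Infinite off the atoms, so that [info_density_le] holds everywhere; the set
off the atoms is negligible for a discrete prior. *)
Definition surprisal (x : R) : \bar R := - lne (pi [set x]).

Lemma mass_fin (x : R) : pi [set x] \is a fin_num.
Proof. exact: fin_num_measure. Qed.

Lemma mass_le1 (x : R) : pi [set x] <= 1.
Proof. exact: probability_le1. Qed.

Lemma surprisal_ge0 x : 0 <= surprisal x.
Proof. by rewrite oppe_ge0 lne_le0 mass_le1. Qed.

Lemma measurable_surprisal : measurable_fun [set: measurableTypeR R] surprisal.
Proof.
apply: (measurableT_comp (@oppe_measurable R setT)).
apply: measurable_lne_fin; last exact: mass_fin.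
(* pi [set x] is the mass of a section of the diagonal *)
have mD : measurable [set w : measurableTypeR R * measurableTypeR R | w.1 == w.2].
  rewrite -[X in measurable X]setTI.
  have mtrue : measurable [set true] by [].
  have := @measurable_fun_eqr _ (measurableTypeR R * measurableTypeR R)%type R setT fst snd
    measurable_fst measurable_snd measurableT _ mtrue.
  by rewrite /preimage/=.
have := @measurable_fun_xsection _ _ (measurableTypeR R) (measurableTypeR R) R pi _ mD.
apply: eq_measurable_fun => x _ /=; congr (pi _).
by apply/seteqP; split => y; rewrite /xsection/= inE/=; [move=> /eqP ->|move=> ->].
Qed.

(** A countable support is cut into at most singletons, on which the integral of
the surprisal is one term of the entropy. *)
Lemma integral_surprisal : discrete_distribution pi ->
  \int[pi]_x surprisal x <= entropy pi.
Proof.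
move=> [A cA piA].
have mS (x : measurableTypeR R) : measurable [set x] by exact: measurable_set1.
have mA : measurable A by exact: (@countable_measurable _ (measurableTypeR R)).
have piNA : pi (~` A) = 0 by rewrite probability_setC// piA subee.
have mf := measurable_surprisal.
rewrite (@ge0_negligible_integral _ _ R pi setT (~` A) surprisal
  (measurableC mA) measurableT mf _ piNA); last first.
  by move=> x _; exact: surprisal_ge0.
rewrite setTD setCK.
have [f finj] := countable_injP _ cA.
(* f enumerates A, so F n has at most one point *)
pose F n := A `&` f @^-1` [set n].
have AF : A = \bigcup_n F n.
  by apply/seteqP; split => x; [move=> Ax; exists (f x)|case=> n _ []].
have F1 n : F n = set0 \/ exists x, F n = [set x].
  have [->|/set0P[x [Ax fx]]] := eqVneq (F n) set0; [by left|right].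
  exists x; apply/seteqP; split => [y [Ay fy]|y ->//].
  by apply: finj; rewrite ?inE// fy -fx.
have mF n : measurable (F n).
  by have [->|[x ->]] := F1 n.
have tF : trivIset setT F.
  apply/trivIsetP => i j _ _ /eqP ij; apply/seteqP; split => // x.
  by move=> [[_ /= fi] [_ /= fj]]; apply: ij; rewrite -fi -fj.
pose a x := (- (fine (pi [set x]) * ln (fine (pi [set x]))))%R%:E.
have aE x : surprisal x * pi [set x] = a x.
  rewrite /surprisal /a; have := mass_fin x; have : 0 <= pi [set x] by [].
  case: (pi [set x]) => // p; rewrite lee_fin le_eqVlt => /predU1P[<- _|p0 _].
    by rewrite mule0/= mul0r oppr0.
  by rewrite lne_EFin//= -EFinM mulNr [(ln p * p)%R]mulrC.
have a0 x : 0 <= a x by rewrite -aE mule_ge0// surprisal_ge0.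
rewrite [in leLHS]AF ge0_integral_bigcup//; last 2 first.
- exact: measurable_funTS.
- by move=> x _; exact: surprisal_ge0.
rewrite (@eq_eseriesr _ _ (fun n => \esum_(x in F n) a x)); last first.
  move=> n _; have [->|[x ->]] := F1 n; first by rewrite integral_set0 esum_set0.
  rewrite esum_set1// -aE -[RHS](integral_cst pi (mS x)).
  by apply: eq_integral => y; rewrite inE/= => ->.
rewrite nneseries_esum; last by move=> n _; exact: esum_ge0.
rewrite -esum_bigcupT// (_ : \bigcup_(k in _) F k = A); last first.
  by rewrite [RHS]AF; apply/seteqP; split => x [n _ Fx]; exists n.
rewrite esum_mkcond /entropy; apply: le_esum => x _.
by case: ifPn => // _; exact: a0.
Qed.

Hypothesis pi_int1 : pi.-integrable setT (fun x => x%:E).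
Hypothesis pi_int2 : pi.-integrable setT (fun x => (x ^+ 2)%:E).
Hypothesis pi_mean0 : \int[pi]_x x%:E = 0.
Hypothesis pi_var1 : \int[pi]_x (x ^+ 2)%:E = 1.
Notation P := (channel_prob pi).

(** The mixture g_s(y) is at least its part coming from the atom at x. *)
Lemma info_density_le s (x y : R) : (0 <= s)%R ->
  (info_density pi s (x, y))%:E <= surprisal x.
Proof.
move=> s0; have g0 := mlr_gt0 pi_int1 pi_int2 pi_mean0 pi_var1 y s0.
rewrite /surprisal; have : 0 <= pi [set x] by [].
have mx : measurable ([set x] : set (measurableTypeR R)) by exact: measurable_set1.
have H : (lr s x y)%:E * pi [set x] <= (mlr pi s y)%:E.
  rewrite -mlrE//.
  apply: (@le_trans _ _ (\int[pi]_(z in [set x]) (lr s z y)%:E)); last first.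
    apply: ge0_subset_integral => //.
    - by apply/measurable_EFinP; exact: measurable_lr1.
    - by move=> z _; rewrite lee_fin ltW// lr_gt0.
  rewrite -[leLHS](integral_cst pi mx) le_eqVlt; apply/orP; left; apply/eqP.
  by apply: eq_integral => z; rewrite inE/= => ->.
move: H; have := mass_fin x; case: (pi [set x]) => // p _.
rewrite -EFinM !lee_fin => H; rewrite le_eqVlt => /predU1P[<-|p0].
  by rewrite /= lexx leey.
rewrite lne_EFin// -EFinN lee_fin /info_density/=.
have := lr_gt0 s x y => l0.
by rewrite lerBlDr -lerBlDl opprK -lnM// ?posrE ?mulr_gt0// ler_ln ?posrE ?mulr_gt0.
Qed.

Lemma info_le_entropy s : (0 <= s)%R -> discrete_distribution pi ->
  entropy pi < +oo -> (info pi s <= fine (entropy pi))%R.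
Proof.
move=> s0 dpi Hfin.
have e0 : 0 <= entropy pi.
  apply: le_trans (integral_surprisal dpi).
  by apply: integral_ge0 => x _; exact: surprisal_ge0.
rewrite -lee_fin fineK ?ge0_fin_numE//.
rewrite -[leLHS](integral_info_density pi_int1 pi_int2 pi_mean0 pi_var1 s0).
apply: le_trans (integral_surprisal dpi).
have mf := measurable_surprisal.
rewrite -[leRHS](ge0_integral_fst pi (normal_prob (0 : R)%R (1 : R)%R) mf surprisal_ge0).
apply: le_integral => //.
- exact: integrable_info_density.
- apply/integrableP; split; first exact: (measurableT_comp mf measurable_fst).
  under eq_integral do rewrite gee0_abs ?surprisal_ge0//.
  rewrite (ge0_integral_fst pi (normal_prob (0 : R)%R (1 : R)%R) mf surprisal_ge0).
  exact: le_lt_trans (integral_surprisal dpi) Hfin.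
- by move=> w _; exact: info_density_le.
Qed.

End entropy_bound.

(** * Smallest minimizers of coercive functions; the function phi *)

Section real_minimization.
Context (R : realType).
Implicit Types f : R -> R.

(** The minimum is attained on [a, b]; by continuity the infimum of the set of
minimizers is a minimizer. *)
Lemma smallest_minimizer_exists f (a b c : R) : 0 < a -> a <= c <= b ->
  (forall s, 0 < s -> {for s, continuous f}) ->
  (forall s, 0 < s -> s < a -> f c < f s) ->
  (forall s, b < s -> f c < f s) ->
  exists s, [/\ 0 < s, forall t, 0 < t -> f s <= f t &
    forall u, 0 < u -> (forall t, 0 < t -> f u <= f t) -> s <= u].
Proof.
move=> a0 /andP[ac cb] fcont fa fb.
have ab : a <= b by exact: le_trans cb.
have [m mab fm] : exists2 m, m \in `[a, b]%R & forall t, t \in `[a, b]%R -> f m <= f t.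
  apply: EVT_min => //; apply: continuous_in_subspaceT => x.
  rewrite inE/= in_itv/= => /andP[ax _]; apply: fcont; exact: lt_le_trans ax.
have m0 : 0 < m by move: mab; rewrite in_itv/= => /andP[am _]; exact: lt_le_trans am.
have fmc : f m <= f c by apply: fm; rewrite in_itv/= ac.
have fmin t : 0 < t -> f m <= f t.
  move=> t0; have [ta|at_] := ltP t a; first by rewrite (le_trans fmc)// ltW// fa.
  have [bt|tb] := ltP b t; first by rewrite (le_trans fmc)// ltW// fb.
  by apply: fm; rewrite in_itv/= at_.
pose S := [set s | 0 < s /\ f s = f m].
have Sa s : S s -> a <= s.
  by move=> [s0 fs]; rewrite leNgt; apply/negP => /(fa _ s0); rewrite fs ltNge fmc.
have Sm : S m by [].
have hS : has_inf S by split; [exists m|exists a => s /Sa].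
have aS : a <= inf S by apply: lb_le_inf => //; exists m.
have i0 : 0 < inf S by exact: lt_le_trans aS.
have fi : f (inf S) <= f m.
  rewrite leNgt; apply/negP => lt.
  have H : \forall t \near nbhs (inf S), f m < f t by exact: cvgr_gt (fcont _ i0) _ lt.
  have /nbhs_ballP[eta /= eta0 near_inf] := H.
  have [s Ss si] := inf_adherent eta0 hS.
  have infs : inf S <= s by apply: ge_inf => //; exact: hS.2.
  have := near_inf s; rewrite /ball/= ler0_norm ?subr_le0// opprB ltrBlDl => /(_ si).
  by rewrite Ss.2 ltxx.
exists (inf S); split => //.
- by move=> t t0; exact: le_trans (fmin _ t0).
- move=> u u0 umin; apply: ge_inf; first exact: hS.2.
  by split=> //; apply/eqP; rewrite eq_le umin// fmin.
Qed.

Lemma phi_ge0 (x : R) : 0 < x -> 0 <= phi x.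
Proof.
move=> x0; rewrite /phi; have := @le_ln1Dx R (x - 1).
have -> : 1 + (x - 1) = x by ring.
have x1 : -1 < x - 1 by lra.
by move=> /(_ x1); lra.
Qed.

Lemma phi_small (K x : R) : 0 < x -> x < expR (- (K + 1)) -> K < phi x.
Proof.
move=> x0 xK; have : ln x < - (K + 1) by rewrite -[ltRHS]expRK ltr_ln ?posrE ?expR_gt0.
rewrite /phi; lra.
Qed.

Lemma phi_large (K x : R) : 0 < x -> 2 * (K + ln 2) < x -> K < phi x.
Proof.
move=> x0 xK; have := @phi_ge0 (x / 2); rewrite divr_gt0// => /(_ isT).
by rewrite /phi ln_div ?posrE//; lra.
Qed.

Lemma phi_continuous (k x : R) : 0 < k -> 0 < x ->
  {for x, continuous (fun s : R => phi (s / k))}.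
Proof.
move=> k0 x0.
have cd : {for x, continuous (fun s : R => s / k)}.
  by apply: cvgM; [exact: cvg_id|exact: cvg_cst].
have cl : {for x, continuous (fun s : R => ln (s / k))}.
  apply: (continuous_comp cd); apply: continuous_ln; exact: divr_gt0.
by apply: cvgB; [apply: cvgB|exact: cvg_cst].
Qed.

End real_minimization.

(** * Where the minimizers of the potential lie *)

Section potential_minimizers.
Context (R : realType).
Variable pi : probability (measurableTypeR R) R.
Hypothesis pi_discrete : discrete_distribution pi.
Hypothesis pi_mean : ('E_pi[idfun] = 0)%E.
Hypothesis pi_variance : ('V_pi[idfun] = 1)%E.
Hypothesis pi_entropy : (entropy pi < +oo)%E.

Lemma second_moment : (\int[pi]_x (x ^+ 2)%:E = 1)%E.
Proof.
rewrite -pi_variance /variance covariance.unlock pi_mean expectation.unlock.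
by apply: eq_integral => x _; congr _%:E; rewrite /= !fctE/= subr0 expr2.
Qed.

Lemma integrable_sqr : pi.-integrable setT (fun x => (x ^+ 2)%:E).
Proof.
apply/integrableP; split; first by apply/measurable_EFinP; exact: measurable_funX.
under eq_integral do rewrite gee0_abs ?lee_fin ?sqr_ge0//.
by rewrite second_moment ltry.
Qed.

Lemma integrable_id : pi.-integrable setT (fun x => x%:E).
Proof.
apply: (@le_integrable _ _ _ pi setT measurableT _ (fun x => 1%:E + (x ^+ 2)%:E)%E).
- exact/measurable_EFinP.
- move=> x _; rewrite -EFinD !abse_EFin lee_fin; apply: le_trans (ler_norm _).
  rewrite ler_norml; have := sqr_ge0 (x - 1); have := sqr_ge0 (x + 1).
  by move=> *; apply/andP; split; nra.
- apply: integrableD => //; last exact: integrable_sqr.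
  exact: finite_measure_integrable_cst.
Qed.

Lemma first_moment : (\int[pi]_x x%:E = 0)%E.
Proof. by rewrite -pi_mean unlock. Qed.

Let i1 := integrable_id.
Let i2 := integrable_sqr.
Let m0 := first_moment.
Let v1 := second_moment.
Notation H := (fine (entropy pi)).
Notation M := (mmse_fun pi).

Lemma output_kl0 : output_kl pi 0 = 0.
Proof.
have mlr0 y : mlr pi 0 y = 1.
  apply: EFin_inj; rewrite -mlrE//.
  transitivity (\int[pi]_x (1%:E : \bar R))%E; last exact: integral_prob_cst.
  by apply: eq_integral => x _; rewrite /lr sqrtr0 !mul0r subr0 expR0.
apply: EFin_inj; rewrite -output_klE//.
under eq_integral do rewrite mlr0 ln1.
by rewrite integral0.
Qed.

#[local] Opaque lr mlr post_mean mmse_fun output_kl info.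

Let infoE s : info pi s = s / 2 - output_kl pi s. Proof. by []. Qed.

Lemma output_kl_ge0 s : 0 <= s -> 0 <= output_kl pi s.
Proof. by move=> s0; rewrite -output_kl0; exact: output_kl_nondecreasing. Qed.

Lemma info_le_half s : 0 <= s -> info pi s <= s / 2.
Proof. by move=> s0; have := output_kl_ge0 s0; rewrite infoE; lra. Qed.

Lemma info_ge0 s : 0 <= s -> 0 <= info pi s.
Proof.
move=> s0; have := @info_nondecreasing _ pi i1 i2 m0 v1 0 s (lexx _) s0.
by apply: le_trans; rewrite infoE output_kl0; lra.
Qed.

Lemma info_ge_mmse s : 0 <= s -> s / 2 - s * (1 - M s) <= info pi s.
Proof. by move=> s0; have := output_kl_le i1 i2 m0 v1 s0; rewrite infoE; lra. Qed.

Lemma entropy_ge0 : 0 <= H.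
Proof.
apply: fine_ge0; apply: le_trans (integral_surprisal pi_discrete).
by apply: integral_ge0 => x _; exact: surprisal_ge0.
Qed.

(** I and s/2 - I are both nondecreasing, so I is 1/2-Lipschitz. *)
Lemma info_continuous s : 0 < s -> {for s, continuous (info pi)}.
Proof.
move=> s0; apply/cvgrPdist_le => /= e e0.
near=> t.
have t0 : 0 < t by near: t; exact: lt_nbhsr.
have lip (a b : R) : 0 <= a -> a <= b -> `|info pi b - info pi a| <= (b - a) / 2.
  move=> a0 ab; have h1 := info_nondecreasing i1 i2 m0 v1 a0 ab.
  have h2 := output_kl_nondecreasing i1 i2 m0 v1 a0 ab.
  rewrite ger0_norm; last by rewrite subr_ge0.
  rewrite !infoE.
  move: h2; clear h1.
  move: (output_kl pi a) (output_kl pi b) => p q pq.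
  lra.
have ste : `|s - t| <= e.
  by near: t; apply/nbhs_ballP; exists e => //= u; rewrite /ball/= => /ltW.
have [st|ts] := leP s t.
  rewrite distrC (le_trans (lip _ _ (ltW s0) st))//.
  by move: ste; rewrite distrC ger0_norm ?subr_ge0//; lra.
rewrite (le_trans (lip _ _ (ltW t0) (ltW ts)))//.
move: ste; rewrite ger0_norm; last by rewrite subr_ge0 ltW.
by move=> h; lra.
Unshelve. all: by end_near. Qed.

Variables delta snr : R.
Hypothesis delta_gt0 : 0 < delta.
Hypothesis snr_gt0 : 0 < snr.

Let ds_gt0 : 0 < delta * snr. Proof. exact: mulr_gt0. Qed.

Definition potential_fun (s : R) : R :=
  info pi s + delta / 2 * phi (s / (delta * snr)).

Lemma potentialE s : 0 <= s -> potential delta snr pi s = (potential_fun s)%:E.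
Proof. by move=> s0; rewrite /potential sl_mutual_informationE. Qed.

Lemma minimizersP s : minimizers (potential delta snr pi) s <->
  0 < s /\ forall t, 0 < t -> potential_fun s <= potential_fun t.
Proof.
split=> -[s0 smin]; split=> // t t0; have := smin t t0.
  by rewrite (potentialE (ltW s0)) (potentialE (ltW t0)) lee_fin.
by rewrite (potentialE (ltW s0)) (potentialE (ltW t0)) lee_fin.
Qed.

Lemma potential_fun_ge_phi s : 0 < s ->
  delta / 2 * phi (s / (delta * snr)) <= potential_fun s.
Proof. by move=> s0; rewrite lerDr info_ge0// ltW. Qed.

Lemma potential_fun_ge_info s : 0 < s -> info pi s <= potential_fun s.
Proof.
move=> s0; rewrite lerDl mulr_ge0//; first by rewrite divr_ge0// ltW.
by apply: phi_ge0; exact: divr_gt0.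
Qed.

Lemma potential_fun_at_top : potential_fun (delta * snr) = info pi (delta * snr).
Proof. by rewrite /potential_fun divff ?gt_eqF// /phi ln1 !subr0 subrr mulr0 addr0. Qed.

(** At c = delta snr the penalty phi vanishes, and far from c it exceeds the
value of the potential there since I >= 0. *)
Lemma smallest_minimizer_spec : let s := smallest_minimizer (potential delta snr pi) in
  0 < s /\ forall t, 0 < t -> potential_fun s <= potential_fun t.
Proof.
pose c := delta * snr; pose K := 2 * info pi c / delta.
have K0 : 0 <= K.
  by rewrite divr_ge0 ?(ltW delta_gt0)// mulr_ge0// info_ge0// ltW.
have cfar s : 0 < s -> K < phi (s / c) -> potential_fun c < potential_fun s.
  move=> s0 Ks; apply: lt_le_trans (potential_fun_ge_phi s0).
  rewrite potential_fun_at_top -/c; move: Ks; rewrite /K ltr_pdivrMr//.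
  by set p := phi _; nra.
have ln2 : 0 <= ln (2 : R) by rewrite ln_ge0// ler1n.
have e1 : expR (- (K + 1)) <= 1 by rewrite -[leRHS]expR0 ler_expR; lra.
have [|||||s [s0 smin sleast]] := @smallest_minimizer_exists R potential_fun
    (c * expR (- (K + 1))) (c * (2 * (K + ln 2) + 1)) c.
- by rewrite mulr_gt0// expR_gt0.
- by rewrite ler_piMr ?(ltW ds_gt0)//= ler_peMr ?(ltW ds_gt0)//; lra.
- move=> s s0; apply: cvgD; first exact: info_continuous.
  by apply: cvgM; [exact: cvg_cst|exact: phi_continuous].
- move=> s s0 sa; apply: cfar => //; apply: phi_small; first exact: divr_gt0.
  by rewrite ltr_pdivrMr// mulrC.
- move=> s bs; have s0 : 0 < s by apply: lt_trans bs; rewrite mulr_gt0//; lra.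
  apply: cfar => //; apply: phi_large; first exact: divr_gt0.
  rewrite ltr_pdivlMr// mulrC; apply: le_lt_trans bs.
  by rewrite ler_pM2l//; lra.
rewrite /smallest_minimizer; case: xgetP => [t _ [/minimizersP//]|/(_ s)[]].
split; first by apply/minimizersP.
by move=> u /minimizersP[u0 umin]; exact: sleast.
Qed.

(** Only upper bounds on this minimizer matter, and the default value 0 satisfies
them all. *)
Lemma largest_minimizer_spec : let s := largest_minimizer (potential delta snr pi) in
  s = 0 \/ (0 < s /\ forall t, 0 < t -> potential_fun s <= potential_fun t).
Proof.
rewrite /largest_minimizer; case: xgetP => [t _ [/minimizersP H _]|_]; first by right.
by left.
Qed.

(** The difference of the two sides is delta/2 times phi at
s (1 + snr) / (delta snr). *)
Lemma linear_branch_ge s : 0 < s ->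
  delta / 2 * ln (1 + snr) <= s / 2 + delta / 2 * phi (s / (delta * snr)).
Proof.
move=> s0; have x0 : 0 < s * (1 + snr) / (delta * snr).
  by rewrite divr_gt0// mulr_gt0// addr_gt0.
have := phi_ge0 x0; rewrite /phi.
rewrite (_ : s * (1 + snr) / (delta * snr) =
  s / (delta * snr) * (1 + snr)); last by field; rewrite !gt_eqF.
rewrite lnM ?posrE ?divr_gt0// ?addr_gt0//.
rewrite (_ : s / (delta * snr) * (1 + snr) = s / (delta * snr) + s / delta); last first.
  by field; rewrite !gt_eqF.
move=> Hphi; rewrite (_ : s / 2 = delta / 2 * (s / delta)); last by field; rewrite gt_eqF.
by rewrite -mulrDr ler_pM2l ?divr_gt0//; lra.
Qed.

(** The test point is the minimizer of the function in [linear_branch_ge]. *)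
Lemma potential_fun_le_linear :
  potential_fun (delta * snr / (1 + snr)) <= delta / 2 * ln (1 + snr).
Proof.
have s1 : 0 < 1 + snr by rewrite addr_gt0.
rewrite /potential_fun (_ : delta * snr / (1 + snr) / (delta * snr) = (1 + snr)^-1); last first.
  by field; rewrite !gt_eqF.
have a0 : 0 <= delta * snr / (1 + snr) by rewrite divr_ge0// ltW.
apply: le_trans (_ : delta * snr / (1 + snr) / 2 +
    delta / 2 * phi (1 + snr)^-1 <= _).
  by apply: lerD => //; exact: info_le_half.
rewrite le_eqVlt; apply/orP; left; apply/eqP.
by rewrite /phi lnV ?posrE//; field; rewrite gt_eqF.
Qed.

Lemma minimizer_above s0 s : 0 <= s0 -> s0 < s ->
  (forall t, 0 < t -> potential_fun s <= potential_fun t) ->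
  info pi s0 <= delta / 2 * ln (1 + snr).
Proof.
move=> s00 s0s smin; have sp : 0 < s by exact: le_lt_trans s0s.
apply: le_trans potential_fun_le_linear.
apply: le_trans (info_nondecreasing i1 i2 m0 v1 s00 (ltW s0s)) _.
apply: le_trans (potential_fun_ge_info sp) _; apply: smin.
by rewrite divr_gt0// addr_gt0.
Qed.

(** The potential is the linear branch minus D; compare with its value I <= H at
delta snr. *)
Lemma minimizer_below s0 s : 0 < s -> s <= s0 ->
  (forall t, 0 < t -> potential_fun s <= potential_fun t) ->
  delta / 2 * ln (1 + snr) - output_kl pi s0 <= H.
Proof.
move=> sp ss0 smin.
have h1 := linear_branch_ge sp.
have h2 := output_kl_nondecreasing i1 i2 m0 v1 (ltW sp) ss0.
have h3 := smin _ ds_gt0.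
have h4 := info_le_entropy i1 i2 m0 v1 (ltW ds_gt0) pi_discrete pi_entropy.
move: h1 h2 h3 h4; rewrite potential_fun_at_top /potential_fun (infoE s).
move: (output_kl pi s) (output_kl pi s0) (info pi _) (fine _).
move: (delta / 2 * ln _) (delta / 2 * phi _) => a b p q u v h1 h2 h3 h4.
lra.
Qed.

(** The ratio of delta to its threshold value. *)
Let c := delta / delta_mmse pi snr.

Let ln_snr_gt0 : 0 < ln (1 + snr).
Proof. by rewrite ln_gt0// ltrDl. Qed.

(** If H = 0, the threshold is 0 and so is the ratio. *)
Lemma entropy_gt0 : 0 < c -> 0 < H.
Proof.
rewrite /c /delta_mmse => c0; rewrite lt_neqAle entropy_ge0 andbT.
by apply/negP => /eqP H0; move: c0; rewrite -H0 mulr0 mul0r invr0 mulr0 ltxx.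
Qed.

Lemma delta_ratioE : 0 < c -> delta / 2 * ln (1 + snr) = c * H.
Proof.
move=> /entropy_gt0 H0; rewrite /c /delta_mmse; field.
by rewrite !gt_eqF.
Qed.

Lemma info_ge_scaled t : 0 < c -> 0 <= t ->
  H * (t * (2 * fine (sl_mmse pi (2 * H * t)) - 1)) <= info pi (2 * H * t).
Proof.
move=> c0 t0; have H0 := entropy_gt0 c0.
have s0 : 0 <= 2 * H * t by rewrite !mulr_ge0// ltW.
rewrite sl_mmseE//=; apply: le_trans (info_ge_mmse s0).
by rewrite le_eqVlt; apply/orP; left; apply/eqP; field.
Qed.

Lemma mmse_at_largest_minimizer t : 0 < c -> 0 <= t ->
  c < t * (2 * fine (sl_mmse pi (2 * H * t)) - 1) ->
  (sl_mmse pi (2 * H * t) <=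
   sl_mmse pi (largest_minimizer (potential delta snr pi)) <= 1)%E.
Proof.
move=> c0 t0 ct; have H0 := entropy_gt0 c0.
have s0 : 0 <= 2 * H * t by rewrite !mulr_ge0// ltW.
have := largest_minimizer_spec; rewrite /=.
move: (largest_minimizer _) => s sP.
have sp : 0 <= s by case: sP => [->//|[/ltW]].
have ss0 : s <= 2 * H * t.
  case: sP => [->//|[s_gt0 smin]]; rewrite leNgt; apply/negP => lt.
  have := minimizer_above s0 lt smin; rewrite delta_ratioE//.
  move/(le_trans (info_ge_scaled c0 t0)); rewrite mulrC ler_pM2r//.
  by rewrite leNgt ct.
rewrite (sl_mmseE i1 i2 m0 v1 s0) (sl_mmseE i1 i2 m0 v1 sp).
apply/andP; split; rewrite lee_fin.
  exact: (mmse_fun_le i1 i2 m0 v1 sp ss0).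
exact: (mmse_fun_le1 i1 i2 m0 v1 sp).
Qed.

Lemma mmse_at_smallest_minimizer t u : 0 < c -> 0 <= u -> u <= t ->
  1 < c - t + u * (2 * fine (sl_mmse pi (2 * H * u)) - 1) ->
  (0 <= sl_mmse pi (smallest_minimizer (potential delta snr pi)) <=
   sl_mmse pi (2 * H * t))%E.
Proof.
move=> c0 u0 ut ct; have H0 := entropy_gt0 c0.
have t0 : 0 <= t by exact: le_trans ut.
have s0 : 0 <= 2 * H * t by rewrite !mulr_ge0// ltW.
have s1 : 0 <= 2 * H * u by rewrite !mulr_ge0// ltW.
have s10 : 2 * H * u <= 2 * H * t by rewrite ler_pM2l// mulr_gt0.
have := smallest_minimizer_spec; rewrite /=.
move: (smallest_minimizer _) => s [sp smin].
have ss0 : 2 * H * t <= s.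
  rewrite leNgt; apply/negP => lt.
  have h1 := minimizer_below sp (ltW lt) smin.
  have h2 := info_nondecreasing i1 i2 m0 v1 s1 s10.
  have h3 := info_ge_scaled c0 u0.
  move: h1 h2 h3; rewrite delta_ratioE// (infoE (2 * H * t)).
  move: ct; move: (u * _) (output_kl pi _) (info pi _) => q p v ct h1 h2 h3.
  have : H * 1 < H * (c - t + q) by rewrite ltr_pM2l.
  have h3' := h3.
  rewrite mulr1 mulrDr mulrBr; move: h1 h2 h3'.
  rewrite (_ : 2 * H * t / 2 = H * t); last by field.
  rewrite [c * H]mulrC.
  move: (H * c) (H * t) (H * q) (fine _) => a b d e; lra.
have sp0 := ltW sp.
rewrite (sl_mmseE i1 i2 m0 v1 sp0) (sl_mmseE i1 i2 m0 v1 s0).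
apply/andP; split; last first.
  by rewrite lee_fin; exact: (mmse_fun_le i1 i2 m0 v1 s0 ss0).
rewrite -(mmse_funE i1 i2 m0 v1 sp0).
by apply: integral_ge0 => w _; rewrite lee_fin sqr_ge0.
Qed.

End potential_minimizers.

(** * The all-or-nothing behaviour *)

Theorem theorem4 (R : realType)
    (pi : R -> probability (measurableTypeR R) R) (delta snr : R -> R) (r : R)
    (pi_discrete : forall e, 0 < e -> discrete_distribution (pi e))
    (pi_mean : forall e, 0 < e -> ('E_(pi e)[idfun] = 0)%E)
    (pi_variance : forall e, 0 < e -> ('V_(pi e)[idfun] = 1)%E)
    (pi_entropy : forall e, 0 < e -> (entropy (pi e) < +oo)%E)
    (mmse_below : forall t, 0 <= t < 1 ->
       sl_mmse (pi e) (2 * fine (entropy (pi e)) * t) @[e --> 0^'+] --> 1%:E)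
    (mmse_above : forall t, 1 < t ->
       sl_mmse (pi e) (2 * fine (entropy (pi e)) * t) @[e --> 0^'+] --> 0%:E)
    (r_gt0 : 0 < r) (r_neq1 : r != 1)
    (delta_gt0 : forall e, 0 < e -> 0 < delta e)
    (snr_gt0 : forall e, 0 < e -> 0 < snr e)
    (delta_lim :
       delta e / delta_mmse (pi e) (snr e) @[e --> 0^'+] --> r) :
  (r < 1 ->
     sl_mmse (pi e)
       (largest_minimizer (potential (delta e) (snr e) (pi e)))
       @[e --> 0^'+] --> 1%:E) /\
  (1 < r ->
     sl_mmse (pi e)
       (smallest_minimizer (potential (delta e) (snr e) (pi e)))
       @[e --> 0^'+] --> 0%:E).

Proof.
pose H e := fine (entropy (pi e)).
pose c e := delta e / delta_mmse (pi e) (snr e).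
have e_gt0 : \forall e \near (0 : R)^'+, 0 < e by exact: nbhs_right_gt.
have c_gt0 : \forall e \near (0 : R)^'+, 0 < c e by exact: (cvgr_gt _ delta_lim).
pose mm t e := fine (sl_mmse (pi e) (2 * H e * t)).
have mm_lim t : 0 <= t < 1 -> mm t e @[e --> (0 : R)^'+] --> (1 : R).
  by move=> /mmse_below /fine_cvg.
(* lower bound for I(2 H t) / H, by [info_ge_scaled] *)
have slack_lim t : 0 <= t < 1 -> t * (2 * mm t e - 1) @[e --> (0 : R)^'+] --> t.
  move=> t01; rewrite -[X in _ --> X](_ : t * (2 * 1 - 1) = t); last by ring.
  apply: cvgM; first exact: cvg_cst.
  apply: cvgB; last exact: cvg_cst.
  by apply: cvgM; [exact: cvg_cst|exact: mm_lim].
split=> [r_lt1|r_gt1].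
- pose t := (1 + r) / 2.
  have t01 : 0 <= t < 1 by rewrite /t; lra.
  have rt : r - t < 0 by rewrite /t; lra.
  have gap : \forall e \near (0 : R)^'+, c e - t * (2 * mm t e - 1) < 0.
    exact: (cvgr_lt _ (cvgB delta_lim (slack_lim _ t01))).
  have bound : \forall e \near (0 : R)^'+,
      (sl_mmse (pi e) (2 * H e * t) <=
       sl_mmse (pi e) (largest_minimizer (potential (delta e) (snr e) (pi e))) <=
       cst 1%:E e)%E.
    near=> e.
    have e0 : 0 < e by near: e.
    have ce0 : 0 < c e by near: e.
    have gape : c e < t * (2 * mm t e - 1) by rewrite -subr_lt0; near: e.
    case/andP: t01 => t0 _.
    exact: (mmse_at_largest_minimizer (pi_discrete _ e0) (pi_mean _ e0)
      (pi_variance _ e0) (delta_gt0 _ e0) (snr_gt0 _ e0) ce0 t0 gape).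
  by apply: (squeeze_cvge bound) => //; [exact: mmse_below|exact: cvg_cst].
- pose t := (1 + r) / 2; pose u := (1 + Num.max 0 ((3 - r) / 2)) / 2.
  (* u < 1 must be so close to 1 that r - t > 1 - u *)
  have [u01 rtu] : 0 <= u < 1 /\ 1 < r - t + u.
    rewrite /u /t; have [m|m] := leP 0 ((3 - r) / 2); split; lra.
  have t1 : 1 < t by rewrite /t; lra.
  have ut : u <= t by lra.
  have gap : \forall e \near (0 : R)^'+, 1 < c e - t + u * (2 * mm u e - 1).
    apply: (cvgr_gt (r - t + u)) => //; apply: cvgD; last exact: slack_lim.
    by apply: cvgB => //; exact: cvg_cst.
  have bound : \forall e \near (0 : R)^'+,
      (cst 0%:E e <=
       sl_mmse (pi e) (smallest_minimizer (potential (delta e) (snr e) (pi e))) <=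
       sl_mmse (pi e) (2 * H e * t))%E.
    near=> e.
    have e0 : 0 < e by near: e.
    have ce0 : 0 < c e by near: e.
    have gape : 1 < c e - t + u * (2 * mm u e - 1) by near: e.
    case/andP: u01 => u0 _.
    exact: (mmse_at_smallest_minimizer (pi_discrete _ e0) (pi_mean _ e0)
      (pi_variance _ e0) (pi_entropy _ e0) (delta_gt0 _ e0) (snr_gt0 _ e0) ce0 u0 ut gape).
  by apply: (squeeze_cvge bound) => //; [exact: cvg_cst|exact: mmse_above].
Unshelve. all: by end_near. Qed.
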